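(* Let $\alpha=\alpha_1\approx 1.75488$ be the real root of $t^3-2t^2+t-1$, let $\beta=\alpha/(\alpha-1)$, and let $$\Xi:=\{u_1\psi(\beta-\alpha)+u_2\psi(\beta-\alpha^2): u_1,u_2\in\mathbb{Z}\}.$$ Then $$\dim_H(\partial\mathcal{F}_\alpha)=\frac{2\log(\mu)}{\log(\alpha)}\approx 1.10026,$$ where $\mu\approx 1.3626$ is the dominant root of $t^5-2t^3+t-1$, and the collection $\{x+\mathcal{F}_\alpha: x\in\Xi\}$ is a proper tiling of $\mathbb{K}_\alpha=\mathbb{C}$.
   Context: Fix a non-real Galois conjugate $\alpha'$ of $\alpha$ and let $\psi:\mathbb{Q}(\alpha)\to\mathbb{C}$ be the field embedding with $\psi(\alpha)=\alpha'$. Both $\alpha$ and $\beta$ are Pisot units, so $f_L(x)=\psi(\alpha)x$ and $f_R(x)=\psi(\beta)(\psi(1)-x)$ are contractions of $\mathbb{C}$. The tent-tile $\mathcal{F}_\alpha$ is the unique non-empty compact set $\mathcal{F}_\alpha\subset\mathbb{C}$ with $\mathcal{F}_\alpha=f_L(\mathcal{F}_\alpha)\cup f_R(\mathcal{F}_\alpha)$. $\dim_H$ denotes Hausdorff dimension and $\partial$ the topological boundary. The dominant root of a polynomial is its root of largest modulus. A collection $\{Y_i:i\in I\}$ of compact subsets of a Euclidean space $\mathbb{E}$ is a (proper) tiling of $\mathbb{E}$ if (1) $\bigcup_{i\in I}Y_i=\mathbb{E}$; (2) for each compact $Y\subset\mathbb{E}$ the set $\{i\in I:Y\cap Y_i\neq\emptyset\}$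 is finite; (3) for Lebesgue-almost every $x\in\mathbb{E}$ the set $\{i\in I:x\in Y_i\}$ has exactly one element. *)

(* Defs.v *)
From HB Require Import structures.
From mathcomp Require Import all_boot all_order all_algebra.
From mathcomp Require Import all_classical all_reals all_analysis.
From mathcomp Require Import complex.
Set Implicit Arguments.
Unset Strict Implicit.
Unset Printing Implicit Defensive.
Import Order.TTheory GRing.Theory Num.Theory.
Import numFieldNormedType.Exports.
Local Open Scope classical_set_scope.
Local Open Scope complex_scope.
Local Open Scope ring_scope.

(** The field Q(alpha), as the subfield of the real numbers consisting of the
    values at alpha of the rational functions with rational coefficients. *)
Section NumberField.
Variables (R : realType) (alpha : R).

Definition in_Qadj : {pred R} := fun x =>
  `[< exists p q : {poly rat}, (map_poly ratr q).[alpha] != 0 /\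
        x = (map_poly ratr p).[alpha] / (map_poly ratr q).[alpha] >].

Fact in_Qadj_divring_closed : divring_closed in_Qadj.
Proof.
split.
- apply/asboolP; exists 1, 1.
  by rewrite rmorph1 hornerC divr1 oner_neq0.
- move=> _ _ /asboolP[p [q [q0 ->]]] /asboolP[r [s [s0 ->]]].
  apply/asboolP; exists (p * s - r * q), (q * s).
  rewrite rmorphB !rmorphM hornerD hornerN !hornerM mulf_neq0//; split=> //.
  by rewrite -mulNr addf_div// mulNr.
- move=> _ _ /asboolP[p [q [q0 ->]]] /asboolP[r [s [s0 ->]]].
  have [r0|r0] := eqVneq (map_poly ratr r).[alpha] 0.
    apply/asboolP; exists 0, 1.
    by rewrite r0 mul0r invr0 mulr0 rmorph0 rmorph1 !hornerC mul0r oner_neq0.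
  apply/asboolP; exists (p * s), (q * r).
  by rewrite !rmorphM !hornerM mulf_neq0//; split=> //; rewrite invf_div mulf_div.
Qed.

HB.instance Definition _ :=
  GRing.isDivringClosed.Build R in_Qadj in_Qadj_divring_closed.

Record Qadj := MkQadj { Qadj_val : R; _ : Qadj_val \in in_Qadj }.

HB.instance Definition _ := [isSub for Qadj_val].
HB.instance Definition _ := [Choice of Qadj by <:].
HB.instance Definition _ := [SubChoice_isSubComUnitRing of Qadj by <:].
HB.instance Definition _ := [SubComUnitRing_isSubIntegralDomain of Qadj by <:].
HB.instance Definition _ := [SubIntegralDomain_isSubField of Qadj by <:].

Fact gen_in_Qadj : alpha \in in_Qadj.
Proof.
apply/asboolP; exists 'X, 1.
by rewrite map_polyX hornerX rmorph1 hornerC divr1 oner_neq0.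
Qed.

(** alpha, as an element of Q(alpha) *)
Definition Qgen : Qadj := MkQadj gen_in_Qadj.

End NumberField.

Section Complex.
Variable R : realType.

(** Same minimal polynomial over Q *)
Definition galois_conjugate (z w : R[i]) : Prop :=
  exists p : {poly rat}, [/\ irreducible_poly p,
    root (map_poly ratr p) z & root (map_poly ratr p) w].

Definition dominant_root (p : {poly R[i]}) (z : R[i]) : Prop :=
  root p z /\ forall w : R[i], root p w -> w != z -> `|w| < `|z|.

(** [R[i]^o] is the complex field with its usual (norm) topology. *)
Definition boundary (A : set R[i]^o) : set R[i]^o := closure A `\` interior A.

Definition ifs_attractor (f g : R[i] -> R[i]) (F : set R[i]^o) : Prop :=
  [/\ compact F, F !=set0 & F = f @` F `|` g @` F].

(** Tilings of the complex plane; almost everywhere refers to the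
    two-dimensional Lebesgue measure, through (x, y) |-> x + iy. *)
Definition proper_tiling (T : Type) (I : set T) (Y : T -> set R[i]^o) : Prop :=
  [/\ forall i, I i -> compact (Y i),
      \bigcup_(i in I) Y i = setT,
      forall K : set R[i]^o, compact K ->
        finite_set [set i | I i /\ K `&` Y i !=set0]
    & {ae (@lebesgue_measure R \x @lebesgue_measure R)%E,
        forall p : R * R, exists! i, I i /\ Y i (p.1 +i* p.2)}].

(** Hausdorff measures and dimension in the complex plane. The diameter of the
    empty set is -oo; in [gauge] the empty set contributes 0, also when s = 0,
    whereas a singleton contributes 0 `^ 0 = 1 when s = 0. *)
Definition diameter (U : set R[i]) : \bar R :=
  ereal_sup [set (Normc.normc (x - y))%:E | x in U & y in U].

Definition gauge (s : R) (U : set R[i]) : \bar R :=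
  if U == set0 then 0%E else (diameter U `^ s)%E.

Definition hausdorff_premeasure (s delta : R) (A : set R[i]) : \bar R :=
  ereal_inf [set (\sum_(0 <= n <oo) gauge s (U n))%E | U in
    [set U : nat -> set R[i] |
       (forall n, (diameter (U n) <= delta%:E)%E) /\ A `<=` \bigcup_n U n]].

Definition hausdorff_measure (s : R) (A : set R[i]) : \bar R :=
  ereal_sup [set hausdorff_premeasure s delta A | delta in [set d : R | 0 < d]].

Definition hausdorff_dim (A : set R[i]) : \bar R :=
  ereal_inf [set s%:E | s in [set s : R | 0 <= s /\ hausdorff_measure s A = 0%E]].

End Complex.

(* Main.v *)
(** Let [q = alpha' - alpha'^2], a non-real root of [q^3 = q - 1]: then
    [psi alpha = q^2], [psi beta = - q^3], [F = q^2 F `|` q^3 (F - 1)], and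
    [Xi] is the set of the [a + b q + c q^2] with [a + c = 0].

    Covering: the points of [F] of the form [- q^e1 - ... - q^ek] with exponents
    of alternating parity realize every value of the height [a + c], because the
    heights reached with exponents at most [n] fill an interval bounded by a
    Padovan number.  Hence [Xi + F] contains the dense set Z[q], and it is closed.

    Neighbours: subdividing two tiles in turn describes the sets
    [F `&` (c + q^k F)] by a finite graph.  All intersections [F `&` (xi + F)],
    [xi != 0], are unions of copies of one set [X], which satisfies
    [X = (q^4 X - q^2) `|` (q^5 X + (1 - q)^2)].  The covering exponent [d] of [X]
    solves [`|q|^(4 d) + `|q|^(5 d) = 1], that is, [d = ln mu / ln rho] for the
    plastic number [rho = `|q|^(-2)]; as [d < 2], distinct tiles overlap in null
    sets and the boundary of [F] is the union of its neighbour intersections.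

    Lower bound: the pieces of [X] of size about [`|q|^n] have offsets
    [q^n t] with [t] in Z[q], where both [t] and its real conjugate are bounded
    near a ball of that size, so boundedly many pieces meet the ball; distinct
    words give distinct pieces since they do so on the real conjugate side.  This
    is the mass distribution argument for the natural weights on the words. *)

Require Import Defs.
From Stdlib Require Import ZArith.
From HB Require Import structures.
From mathcomp Require Import all_boot all_order all_algebra.
From mathcomp Require Import all_classical all_reals all_analysis.
From mathcomp Require Import complex ring lra zify ssrZ.
Set Implicit Arguments.
Unset Strict Implicit.
Unset Printing Implicit Defensive.
Import Order.TTheory GRing.Theory Num.Theory.
Import numFieldNormedType.Exports.
Local Open Scope classical_set_scope.
Local Open Scope complex_scope.
Local Open Scope ring_scope.

(** * The complex plane as a metric space *)

Local Notation normc := Normc.normc.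

Section ComplexMetric.
Variable R : realType.
Implicit Types (z w : R[i]) (A : set R[i]^o).

Lemma normcE z : `|z| = (normc z)%:C.
Proof. by rewrite normc_def; case: z. Qed.

Lemma normc_ge0 z : 0 <= normc z.
Proof. by case: z => a b; exact: sqrtr_ge0. Qed.

Lemma normc_sqr z : normc z ^+ 2 = complex.Re z ^+ 2 + complex.Im z ^+ 2.
Proof. by case: z => a b /=; rewrite sqr_sqrtr// addr_ge0 ?sqr_ge0. Qed.

Lemma normcD z w : normc (z + w) <= normc z + normc w.
Proof. exact: (@le_normcD R z w). Qed.

Lemma normcN z : normc (- z) = normc z.
Proof. exact: (@complex.normcN R z). Qed.

Lemma normcB z w : normc (z - w) = normc (w - z).
Proof. by rewrite -normcN opprB. Qed.

Lemma normc_dist z w u : normc (z - u) <= normc (z - w) + normc (w - u).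
Proof. by rewrite (le_trans _ (normcD _ _))// addrA subrK. Qed.

Lemma normcX z n : normc (z ^+ n) = normc z ^+ n.
Proof.
elim: n => [|n IHn]; first by rewrite !expr0 Normc.normc1.
by rewrite !exprS Normc.normcM IHn.
Qed.

Lemma normc_gt0 z : z != 0 -> 0 < normc z.
Proof.
move=> z0; rewrite lt_def normc_ge0 andbT.
by apply: contra z0 => /eqP/Normc.eq0_normc ->.
Qed.

Lemma normc_real (x : R) : normc x%:C = `|x|.
Proof. by rewrite /= expr0n addr0 sqrtr_sqr. Qed.

Lemma Re_le_normc z : `|complex.Re z| <= normc z.
Proof. by case: z => a b /=; rewrite -sqrtr_sqr ler_wsqrtr// lerDl sqr_ge0. Qed.

Lemma Im_le_normc z : `|complex.Im z| <= normc z.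
Proof. by case: z => a b /=; rewrite -sqrtr_sqr ler_wsqrtr// lerDr sqr_ge0. Qed.

Lemma normc_le_ReIm z : normc z <= `|complex.Re z| + `|complex.Im z|.
Proof.
rewrite -(ler_pXn2r (n := 2)) ?nnegrE ?normc_ge0 ?addr_ge0// normc_sqr.
rewrite sqrrD !real_normK ?num_real// lerD2r lerDl.
by rewrite mulrn_wge0// mulr_ge0.
Qed.

(** The positive elements of [R[i]] are the positive reals, so balls with a complex radius reduce to
    balls with a real one. *)
Lemma nbhs_normcP (z : R[i]^o) A :
  nbhs z A <-> exists2 e : R, 0 < e & forall x, normc (x - z) < e -> A x.
Proof.
split=> [/nbhs_ballP[[e i] /= ]|[e e0 eA]].
  rewrite ltcE/= => /andP[/eqP i0 e0] eA; subst i; exists e => // x xz.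
  by apply: eA; rewrite -ball_normE /ball_ /= normcE normcB ltcR.
apply/nbhs_ballP; exists e%:C; first by rewrite /= ltcR.
by move=> x; rewrite -ball_normE /ball_ /= normcE normcB ltcR => /eA.
Qed.

Lemma closure_normcP A (z : R[i]) :
  closure A z <-> forall e : R, 0 < e -> exists2 x, A x & normc (x - z) < e.
Proof.
split=> [zA e e0|zA B /nbhs_normcP[e e0 eB]].
  have [] := zA [set x | normc (x - z) < e].
    by apply/nbhs_normcP; exists e.
  by move=> x [Ax xz]; exists x.
by have [x Ax xz] := zA e e0; exists x; split => //; exact: eB.
Qed.

Lemma interior_normcP A (z : R[i]) :
  interior A z <-> exists2 e : R, 0 < e & forall x, normc (x - z) < e -> A x.
Proof. exact: nbhs_normcP. Qed.

Lemma closed_normcP A : closed A <->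
  forall z : R[i],
    (forall e : R, 0 < e -> exists2 x, A x & normc (x - z) < e) -> A z.
Proof.
split=> [cA z zA|cA]; first by apply: cA; apply/closure_normcP.
by move=> z /closure_normcP zA; exact: cA.
Qed.

Lemma compact_closed_normc A : compact A ->
  forall z : R[i],
    (forall e : R, 0 < e -> exists2 x, A x & normc (x - z) < e) -> A z.
Proof.
by move=> cA; apply/closed_normcP; apply: compact_closed => //; exact: norm_hausdorff.
Qed.

Lemma open_normc_ball z (r : R) :
  open ([set x | normc (x - z) < r] : set R[i]^o).
Proof.
move=> x /= xz; apply/nbhs_normcP; exists (r - normc (x - z)).
  by rewrite subr_gt0.
move=> y yx /=; apply: le_lt_trans (normc_dist y x z) _.
by rewrite -ltrBrDr.
Qed.

Lemma compact_ball_cover A (c : nat -> R[i]) (r : nat -> R) : compact A ->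
  (forall z, A z -> exists n, normc (z - c n) < r n) ->
  exists m, forall z, A z -> exists2 n, (n < m)%N & normc (z - c n) < r n.
Proof.
rewrite compact_cover => cA Ar.
have [] := cA nat setT (fun n => [set x | normc (x - c n) < r n]).
- by move=> n _; exact: open_normc_ball.
- by move=> z /Ar[n zn]; exists n.
move=> D _ AD; exists (\max_(n <- finmap.enum_fset D) n).+1 => z /AD[n /= nD zn].
by exists n => //; rewrite ltnS; exact: (leq_bigmax_seq _ nD).
Qed.

Lemma compact_normc_bounded A : compact A ->
  exists2 M : R, 0 < M & forall z, A z -> normc z <= M.
Proof.
move=> /(@compact_ball_cover _ (fun=> 0) (fun n => n%:R))[].
  move=> z _; exists (Num.truncn (normc z)).+1.
  by rewrite subr0 truncnS_gt.
move=> m Am; exists m.+1%:R => // z /Am[n nm].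
by rewrite subr0 => /ltW/le_trans; apply; rewrite ler_nat ltnW// ltnS ltnW.
Qed.

Lemma compact_affine A (a b : R[i]) : compact A ->
  compact ([set a * x + b | x in A] : set R[i]^o).
Proof.
move=> cA; apply: (@continuous_compact _ _ (fun x : R[i]^o => (a * x + b) : R[i]^o)) => //.
apply: continuous_subspaceT => x A' /nbhs_normcP[e e0 eA].
(* The added 1 covers the case [a = 0]. *)
have a1 : 0 < normc a + 1 by rewrite ltr_wpDl// normc_ge0.
apply/nbhs_normcP; exists (e / (normc a + 1)); first by rewrite divr_gt0.
move=> y yx; apply: eA => /=.
rewrite (_ : _ - _ = a * (y - x)); last by ring.
rewrite Normc.normcM.
rewrite ltr_pdivlMr// in yx.
apply: le_lt_trans yx; rewrite mulrC ler_wpM2l ?normc_ge0// lerDl//.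
Qed.

End ComplexMetric.

(** * Null sets for the Hausdorff and the Lebesgue measures *)

Lemma geometric_small (R : realType) (u C e : R) : 0 <= u -> u < 1 -> 0 < e ->
  exists N, forall n, (N <= n)%N -> u ^+ n * C <= e.
Proof.
move=> u0 u1 e0; have C0 : 0 < `|C| + 1 by rewrite ltr_wpDl.
have /cvgrPdist_lt/(_ (e / (`|C| + 1))) : (GRing.exp u : nat -> R) @ \oo --> (0 : R).
  by apply: cvg_expr; rewrite ger0_norm.
rewrite divr_gt0// => /(_ isT)[N _ uN]; exists N => n nN; have /= := uN n nN.
rewrite sub0r normrN ger0_norm ?exprn_ge0// ltr_pdivlMr// => /ltW/(le_trans _); apply.
by rewrite ler_wpM2l ?exprn_ge0// (le_trans (ler_norm _))// lerDl.
Qed.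

Section BallNull.
Variable R : realType.
Implicit Types (z w a b : R[i]) (A B : set R[i]) (s e : R).

(** Nullity by finite ball covers. It passes to finite unions and through similarities; it implies
    Hausdorff measure zero for [s > 0] and Lebesgue negligibility for [s = 2]. *)
Definition ball_null s A := forall e, 0 < e ->
  exists l : seq (R[i] * R), [/\ {in l, forall p, 0 <= p.2 <= e},
    forall z, A z -> exists2 p, p \in l & normc (z - p.1) <= p.2
  & \sum_(p <- l) p.2 `^ s <= e].

Lemma ball_null_sub s A B : A `<=` B -> ball_null s B -> ball_null s A.
Proof. by move=> AB nB e /nB[l [le lA ls]]; exists l; split => // z /AB/lA. Qed.

Lemma ball_null0 s : ball_null s set0.
Proof. by move=> e e0; exists [::]; split => //; rewrite big_nil ltW. Qed.

Lemma ball_nullU s A B : ball_null s A -> ball_null s B -> ball_null s (A `|` B).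
Proof.
move=> nA nB e e0; have e2 : 0 < e / 2 by rewrite divr_gt0.
have [l [le lA ls]] := nA _ e2; have [k [ke kB ks]] := nB _ e2.
exists (l ++ k); split.
- move=> p; rewrite mem_cat => /orP[/le|/ke] /andP[-> pe] /=; apply: (le_trans pe);
    by rewrite ler_pdivrMr// ler_pMr// ler1n.
- move=> z [/lA|/kB] [p pl zp]; exists p => //; rewrite mem_cat pl ?orbT//.
- by rewrite big_cat/= [leRHS](splitr e) lerD.
Qed.

Lemma ball_null_affine s A B a b : a != 0 ->
  (forall z, A z -> B (a * z + b)) -> ball_null s B -> ball_null s A.
Proof.
move=> a0 AB nB e e0; have na : 0 < normc a by exact: normc_gt0.
have as0 : 0 < normc a `^ s by rewrite powR_gt0.
(* Pulling a ball back divides its radius by [|a|] and the sum of powers by [|a|^s], hence the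
   minimum. *)
have [|l [le lA ls]] := nB (Num.min (e * normc a) (e * normc a `^ s)).
  by rewrite lt_min !mulr_gt0.
exists [seq ((p.1 - b) / a, p.2 / normc a) | p <- l]; split.
- move=> _ /mapP[p /le/andP[p0 pe] ->] /=; move: pe; rewrite le_min => /andP[pe _].
  by rewrite divr_ge0 ?(ltW na)//= ler_pdivrMr.
- move=> z /AB/lA[p pl zp]; exists ((p.1 - b) / a, p.2 / normc a).
    by apply/mapP; exists p.
  rewrite /= ler_pdivlMr// -Normc.normcM.
  by rewrite (_ : _ * a = a * z + b - p.1)//; field.
- rewrite big_map /=.
  rewrite (eq_big_seq (fun p : R[i] * R => p.2 `^ s / normc a `^ s)); last first.
    move=> p /le/andP[p0 _]; rewrite powRM// ?invr_ge0 ?(ltW na)//.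
    by rewrite -(powR_inv1 (ltW na)) -powRrM mulN1r powRN.
  rewrite -mulr_suml ler_pdivrMr// (le_trans ls)// ge_min lexx orbT//.
Qed.

(* A set covered by two smaller copies of itself inherits, at each iteration of
   a ball cover, the radii multiplied by the ratios. *)
Lemma ball_null_selfsimilar s A a1 b1 a2 b2 (M : R) : 0 < s ->
  (forall z, A z -> normc z <= M) ->
  a1 != 0 -> a2 != 0 -> normc a1 < 1 -> normc a2 < 1 ->
  normc a1 `^ s + normc a2 `^ s < 1 ->
  (forall z, A z -> A ((z - b1) / a1) \/ A ((z - b2) / a2)) ->
  ball_null s A.
Proof.
move=> s0 AM a10 a20 a1lt a2lt; set t := _ + _ => t1 Asplit e e0.
have na1 := normc_gt0 a10; have na2 := normc_gt0 a20.
set k := Num.max (normc a1) (normc a2).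
have k1 : k < 1 by rewrite gt_max a1lt.
have k0 : 0 < k by rewrite lt_max na1.
have t0 : 0 < t by rewrite addr_gt0 ?powR_gt0.
pose K := Num.max M 1; have K0 : 0 < K by rewrite lt_max ltr01 orbT.
have cover n : exists l : seq (R[i] * R),
    [/\ {in l, forall p, 0 <= p.2 <= k ^+ n * K},
    forall z, A z -> exists2 p, p \in l & normc (z - p.1) <= p.2
    & \sum_(p <- l) p.2 `^ s <= t ^+ n * K `^ s].
  elim: n => [|n [l [lk lA ls]]].
    exists [:: (0, K)]; split.
    - by move=> p; rewrite inE => /eqP ->; rewrite /= expr0 mul1r lexx ltW.
    - move=> z /AM zM; exists (0, K); rewrite ?inE//= subr0 (le_trans zM)//.
      by rewrite le_max lexx.
    - by rewrite big_seq1 expr0 mul1r.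
  pose img a b := [seq (a * p.1 + b, normc a * p.2) | p <- l].
  have imgP a b z : a != 0 -> A ((z - b) / a) ->
      exists2 p, p \in img a b & normc (z - p.1) <= p.2.
    move=> a0 /lA[p pl zp]; exists (a * p.1 + b, normc a * p.2).
      by apply/mapP; exists p.
    rewrite /= (_ : z - _ = a * ((z - b) / a - p.1)); last by field.
    by rewrite Normc.normcM ler_wpM2l// normc_ge0.
  have imgk a b : normc a <= k -> {in img a b, forall p, 0 <= p.2 <= k ^+ n.+1 * K}.
    move=> ak _ /mapP[p /lk/andP[p0 pk] ->] /=.
    rewrite mulr_ge0 ?normc_ge0//= exprS -mulrA ler_pM ?normc_ge0//.
  exists (img a1 b1 ++ img a2 b2); split.
  - move=> p; rewrite mem_cat => /orP[]; apply: imgk; rewrite le_max lexx ?orbT//.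
  - move=> z /Asplit[] /imgP => [/(_ a10)|/(_ a20)] [p pi zp]; exists p => //.
      by rewrite mem_cat pi.
    by rewrite mem_cat pi orbT.
  - have sumI a b : \sum_(p <- img a b) p.2 `^ s = normc a `^ s * \sum_(p <- l) p.2 `^ s.
      rewrite big_map mulr_sumr; apply: eq_big_seq => p /lk/andP[p0 _] /=.
      by rewrite powRM// normc_ge0.
    by rewrite big_cat/= !sumI -mulrDl -/t exprS -mulrA ler_wpM2l// ltW.
have [N1 kN] := geometric_small K (ltW k0) k1 e0.
have [N2 tN] := geometric_small (K `^ s) (ltW t0) t1 e0.
have [l [lk lA ls]] := cover (maxn N1 N2).
exists l; split => //.
- by move=> p /lk/andP[-> pk]; apply: (le_trans pk); rewrite kN// leq_maxl.
- by apply: (le_trans ls); rewrite tN// leq_maxr.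
Qed.

Lemma diameter_ball_le (c : R[i]) (r : R) :
  (diameter [set z : R[i] | (normc (z - c) <= r)%R] <= (2 * r)%:E)%E.
Proof.
apply: ge_ereal_sup => _ [x /= xc [y yc <-]].
rewrite lee_fin (le_trans (normc_dist _ c _))// mulr_natl mulr2n lerD//.
by rewrite normcB.
Qed.

Lemma diameter_ge0 A : A !=set0 -> (0 <= diameter A)%E.
Proof.
move=> [x Ax]; apply: ereal_sup_ge; exists 0%E => //.
by exists x => //; exists x => //; rewrite subrr Normc.normc0.
Qed.

Lemma gauge_ge0 s A : (0 <= gauge s A)%E.
Proof. by rewrite /gauge; case: ifP => // _; exact: poweR_ge0. Qed.

Lemma hausdorff_premeasure_ge0 s (d : R) A : (0 <= hausdorff_premeasure s d A)%E.
Proof.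
apply: le_ereal_inf_tmp => _ [U _ <-]; apply: nneseries_ge0 => n _ _.
exact: gauge_ge0.
Qed.

Lemma gauge_ball_le s (c : R[i]) (r : R) : 0 < s -> 0 <= r ->
  (gauge s [set z : R[i] | (normc (z - c) <= r)%R] <= ((2 * r) `^ s)%:E)%E.
Proof.
move=> s0 r0; rewrite /gauge; case: ifPn => [_|/set0P ne].
  by rewrite lee_fin powR_ge0.
have := diameter_ball_le c r; have := diameter_ge0 ne.
case: (diameter _) => [x| |] //=; rewrite !lee_fin => x0 xr.
by rewrite ge0_ler_powR ?(ltW s0)// nnegrE mulr_ge0.
Qed.

Lemma ball_null_hausdorff s A : 0 < s -> ball_null s A -> hausdorff_measure s A = 0%E.
Proof.
move=> s0 nA; rewrite /hausdorff_measure.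
have H (d : R) : 0 < d -> hausdorff_premeasure s d A = 0%E.
  move=> d0; apply/eqP; rewrite eq_le hausdorff_premeasure_ge0 andbT.
  apply/lee_addgt0Pr => e e0; rewrite add0e.
  have p2 : 0 < 2 `^ s :> R by rewrite powR_gt0.
  (* Passing from radii to diameters costs a factor 2 in size and [2^s] in the sum. The finite list
     is padded by empty sets, whose gauge is 0. *)
  have [|l [le lA ls]] := nA (Num.min (d / 2) (e / 2 `^ s)).
    by rewrite lt_min !divr_gt0.
  pose p n := nth (0 : R[i], 0 : R) l n.
  pose U n := if (n < size l)%N
              then [set z : R[i] | normc (z - (p n).1) <= (p n).2] else set0.
  apply: ge_ereal_inf; exists (\sum_(0 <= n <oo) gauge s (U n))%E.
    exists U => //; split => [n|z /lA[q ql zq]]; last first.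
      exists (index q l) => //; rewrite /U index_mem ql /p nth_index//.
    rewrite /U; case: ifPn => [nl|_]; last first.
      by apply: ge_ereal_sup => x [].
    rewrite (le_trans (diameter_ball_le _ _))// lee_fin mulrC -ler_pdivlMr//.
    have /andP[_] := le _ (mem_nth (0, 0) nl).
    by rewrite le_min => /andP[].
  rewrite (nneseries_split 0 (size l)); last by move=> k _; exact: gauge_ge0.
  rewrite add0n eseries0 ?adde0; last first.
    by move=> i li _; rewrite /U ltnNge li /gauge eqxx.
  apply: (@le_trans _ _ (\sum_(0 <= k < size l) ((2 * (p k).2) `^ s)%:E)%E).
    rewrite big_seq [leRHS]big_seq; apply: lee_sum => k.
    rewrite mem_index_iota => /andP[_ kl].
    rewrite /U kl gauge_ball_le//.
    by have /andP[] := le _ (mem_nth (0, 0) kl).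
  rewrite sumEFin lee_fin.
  rewrite -(big_nth (0, 0) xpredT (fun q : R[i] * R => (2 * q.2) `^ s)).
  rewrite (eq_big_seq (fun q : R[i] * R => 2 `^ s * q.2 `^ s)); last first.
    by move=> q /le/andP[q0 _]; rewrite powRM.
  rewrite -mulr_sumr mulrC -ler_pdivlMr// (le_trans ls)// ge_min lexx orbT//.
rewrite (_ : [set _ | _ in _] = [set 0%E]) ?ereal_sup1//.
apply/seteqP; split => [_ [d /= d0 <-]|_ ->]; first exact: H.
by exists 1; rewrite /= ?H ?ltr01.
Qed.

Local Notation lebesgue2 := (@lebesgue_measure R \x @lebesgue_measure R)%E.

Lemma lebesgue2_square (a b r : R) : 0 <= r ->
  lebesgue2 (`[a - r, a + r] `*` `[b - r, b + r]) = ((2 * r) ^+ 2)%:E.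
Proof.
move=> r0; rewrite product_measure1E//= !lebesgue_measure_itv/= !lte_fin.
have [->|rn] := eqVneq r 0.
  by rewrite !addr0 !subr0 !ltxx mul0e mulr0 expr0n.
have rp : 0 < r by rewrite lt_def rn.
have lt_r x : x - r < x + r by lra.
rewrite !lt_r.
by rewrite -!EFinB -EFinM; congr (_%:E); ring.
Qed.

(** Each ball is replaced by its circumscribed square, of area [4 p^2]. The [n]-th union of squares
    has area at most [4 / (n + 1)], so the intersection of these unions is a measurable null set. *)
Lemma ball_null_negligible A : ball_null 2 A ->
  lebesgue2.-negligible [set p : R * R | A (p.1 +i* p.2)].
Proof.
move=> nA.
have /choice[l Pl] : forall n : nat, exists l : seq (R[i] * R),
    [/\ {in l, forall p, 0 <= p.2}, forall z, A z ->
       exists2 p, p \in l & normc (z - p.1) <= p.2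
    & \sum_(p <- l) p.2 `^ 2 <= n.+1%:R^-1].
  move=> n; have [|l [le lA ls]] := nA (n.+1%:R^-1); first by rewrite invr_gt0.
  by exists l; split => // p /le/andP[].
pose sq (p : R[i] * R) := `[complex.Re p.1 - p.2, complex.Re p.1 + p.2] `*`
   `[complex.Im p.1 - p.2, complex.Im p.1 + p.2] : set (R * R).
have msq p : measurable (sq p) by apply: measurableX; exact: measurable_itv.
pose S n := \big[setU/set0]_(p <- l n) sq p.
have mS n : measurable (S n) by apply: bigsetU_measurable.
exists (\bigcap_n S n); split.
- exact: bigcapT_measurable.
- apply/eqP; rewrite eq_le measure_ge0 andbT.
  apply/lee_addgt0Pr => e e0; rewrite add0e.
  have [n ne] : exists n : nat, 4 / n.+1%:R <= e.
    exists (Num.truncn (4 / e)); rewrite ler_pdivrMr// mulrC -ler_pdivrMr//.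
    by rewrite ltW// truncnS_gt.
  have [l0 _ ls] := Pl n.
  apply: (@le_trans _ _ (lebesgue2 (S n))).
    apply: le_measure; rewrite ?inE//; [exact: bigcapT_measurable|exact: mS|].
    by move=> x; apply.
  apply: (@le_trans _ _ (\sum_(p <- l n) lebesgue2 (sq p))%E).
    rewrite /S; elim: (l n) => [|p s IH]; first by rewrite !big_nil measure0.
    rewrite !big_cons; apply: (le_trans (measureU2 _ _ _)); [exact: msq| |].
      by apply: bigsetU_measurable => i _; exact: msq.
    by rewrite leeD2l.
  rewrite (eq_big_seq (fun p : R[i] * R => (4 * p.2 `^ 2)%:E)); last first.
    move=> p /l0 p0; rewrite lebesgue2_square// exprMn powR_mulrn//.
    by congr (_%:E); ring.
  rewrite sumEFin lee_fin -mulr_sumr (le_trans _ ne)//.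
  by rewrite ler_wpM2l.
- move=> [x y] /= Axy n _; have [_ lA _] := Pl n.
  have [p pl xyp] := lA _ Axy.
  rewrite /S -bigcup_seq; exists p => //=.
  have := le_trans (Re_le_normc _) xyp; have := le_trans (Im_le_normc _) xyp.
  case: p {pl xyp} => -[a b] r /=; rewrite !ler_norml => /andP[h1 h2] /andP[h3 h4].
  by split; rewrite /= in_itv/=; apply/andP; split; lra.
Qed.

Lemma lebesgue2_setT : ~ lebesgue2.-negligible [set: R * R].
Proof.
move=> [B [mB B0 TB]].
pose Q : set (R * R) := `[0 - 1, 0 + 1] `*` `[0 - 1, 0 + 1].
have : (lebesgue2 Q <= lebesgue2 B)%E.
  apply: le_measure; rewrite ?inE//; last by move=> x _; exact: TB.
  by apply: measurableX; exact: measurable_itv.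
by rewrite /Q lebesgue2_square// B0 lee_fin; lra.
Qed.

End BallNull.

(** * The ring of integers *)

(* The triple (a, b, c) stands for a + b x + c x^2, where x^3 = x - 1. *)
Definition triple := (Z * Z * Z)%type.

Definition tadd (s t : triple) : triple :=
  let: (a, b, c) := s in let: (a', b', c') := t in
  (Z.add a a', Z.add b b', Z.add c c').
Definition topp (t : triple) : triple :=
  let: (a, b, c) := t in (Z.opp a, Z.opp b, Z.opp c).
Definition tmulx (t : triple) : triple :=
  let: (a, b, c) := t in (Z.opp c, Z.add a c, b).
(** From [x^3 = x - 1] follows [1 / x = 1 - x^2]: [x] is a unit and division stays within integral
    triples. *)
Definition tdivx (t : triple) : triple :=
  let: (a, b, c) := t in (Z.add b a, c, Z.opp a).

Lemma tdivxK : cancel tdivx tmulx.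
Proof. by move=> [[a b] c] /=; congr (_, _, _); lia. Qed.

(** Coefficients are binary integers so that the neighbour graph can be computed by [vm_compute];
    [zr] carries them into a ring. *)
Definition zr (K : pzRingType) (z : Z) : K := (int_of_Z z)%:~R.

Section Zr.
Variable K : pzRingType.
Lemma zrE z : zr K z = (int_of_Z z)%:~R.
Proof. by []. Qed.
Lemma zrD a b : zr K (Z.add a b) = zr K a + zr K b.
Proof. by rewrite /zr (raddfD int_of_Z) rmorphD. Qed.
Lemma zrN a : zr K (Z.opp a) = - zr K a.
Proof. by rewrite /zr (raddfN int_of_Z) rmorphN. Qed.
Lemma zrM a b : zr K (Z.mul a b) = zr K a * zr K b.
Proof. by rewrite /zr (rmorphM int_of_Z) rmorphM. Qed.
Lemma zrB a b : zr K (Z.sub a b) = zr K a - zr K b.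
Proof. by rewrite -zrN -zrD. Qed.
Lemma zr0 : zr K Z0 = 0. Proof. by []. Qed.
Lemma zr1 : zr K (Zpos xH) = 1. Proof. by []. Qed.
End Zr.

Section Evaluation.
Variables (K : fieldType) (x : K).
Hypothesis x3 : x ^+ 3 = x - 1.
Definition tev (t : triple) : K :=
  let: (a, b, c) := t in zr K a + zr K b * x + zr K c * x ^+ 2.

Lemma tev_add s t : tev (tadd s t) = tev s + tev t.
Proof. by case: s => -[a b] c; case: t => -[a' b'] c' /=; rewrite !zrD; ring. Qed.

Lemma tev_opp t : tev (topp t) = - tev t.
Proof. by case: t => -[a b] c /=; rewrite !zrN; ring. Qed.

Lemma tev_mulx t : tev (tmulx t) = x * tev t.
Proof.
case: t => -[a b] c /=; rewrite !zrD zrN.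
rewrite [RHS](_ : _ = zr K a * x + zr K b * x ^+ 2 + zr K c * x ^+ 3); last by ring.
by rewrite x3; ring.
Qed.

Lemma cubic_root_neq0 : x != 0.
Proof.
apply/eqP => x0; have := x3; rewrite x0 expr0n sub0r => /eqP.
by rewrite eq_sym oppr_eq0 oner_eq0.
Qed.

Lemma tev_divx t : tev (tdivx t) = tev t / x.
Proof.
rewrite -{2}[t]tdivxK tev_mulx mulrAC mulfV ?mul1r//.
exact: cubic_root_neq0.
Qed.

Lemma tev_mulx_iter n t : tev (iter n tmulx t) = x ^+ n * tev t.
Proof. by elim: n => [|n IH] /=; rewrite ?mul1r// tev_mulx IH mulrA -exprS. Qed.

Lemma tev_divx_iter n t : tev (iter n tdivx t) = tev t / x ^+ n.
Proof.
elim: n => [|n IH] /=; first by rewrite divr1.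
by rewrite tev_divx IH exprS invfM mulrA mulrAC.
Qed.

End Evaluation.

(** The roots of [t^3 - t + 1] have sum 0 and product -1, so the real one is [- rho] and
    [|q|^2 = 1 / rho = rho^2 - 1]. The computation starts from the imaginary part of the cubic,
    divided by [Im q]. *)
Lemma plastic_of_complex_root (R : realType) (q : R[i]) : q ^+ 3 = q - 1 ->
  complex.Im q != 0 ->
  let rho := 2 * complex.Re q in
  rho ^+ 3 = rho + 1 /\ normc q ^+ 2 = rho ^+ 2 - 1.
Proof.
case: q => x y; rewrite normc_sqr !exprS expr0 /=.
move=> [/= e1 e2] y0.
have y2 : y ^+ 2 = 3 * x ^+ 2 - 1.
  apply: (mulfI y0); move: e2; rewrite !(mulr1, mulr0, addr0, add0r, subr0, oppr0).
  by move=> e2'; lra.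
split; last by rewrite !expr0 !mulr1 -!expr2 y2; ring.
have : x ^+ 3 - 3 * x * y ^+ 2 = x - 1.
  move: e1; rewrite !(mulr1, mulr0, addr0, add0r, subr0, oppr0) => <-; ring.
by rewrite y2 => e; lra.
Qed.

Lemma plastic_bounds (R : realType) (rho : R) : rho ^+ 3 = rho + 1 ->
  1 + 324 / 10 ^+ 3 + 717 / 10 ^+ 6 + 95 / 10 ^+ 8 < rho < 1 + 324 / 10 ^+ 3 + 717 / 10 ^+ 6 + 96 / 10 ^+ 8.
Proof.
move=> r3; have r0 : 1 < rho.
  rewrite ltNge; apply/negP => r1.
  (* For [rho < 0] the cubic is at most [- (2 rho + 1)^2 / 2 - 1 / 2]. *)
  have : rho ^+ 3 - rho - 1 < 0.
    have [r2|r2] := leP 0 rho.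
      have : 0 <= rho * ((1 - rho) * (1 + rho)) by rewrite !mulr_ge0//; lra.
      by lra.
    have : 0 <= - rho * (rho + 1) ^+ 2 by rewrite mulr_ge0 ?sqr_ge0//; lra.
    by have := sqr_ge0 (2 * rho + 1); lra.
  by rewrite r3; lra.
(* Since [t^3 - t] increases beyond 1, it is enough to evaluate it at the two end points. *)
have mono (u v : R) : 1 <= u -> u <= v -> u ^+ 3 - u <= v ^+ 3 - v.
  move=> u1 uv; rewrite -subr_ge0.
  rewrite (_ : _ - _ = (v - u) * (v ^+ 2 + v * u + u ^+ 2 - 1)); last by ring.
  by rewrite mulr_ge0 ?subr_ge0//; nra.
apply/andP; split; rewrite ltNge; apply/negP => h.
  by have := mono _ _ (ltW r0) h; rewrite r3; lra.
have := mono _ _ _ h; rewrite r3 => mono'.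
have /mono' : 1 <= 1 + 324 / 10 ^+ 3 + 717 / 10 ^+ 6 + 96 / 10 ^+ 8 :> R by lra.
by lra.
Qed.

(** * The neighbour graph *)

Delimit Scope Z_scope with coqZ.

Definition tri (a b c : Z) : triple := (a, b, c).
Arguments tri (a b c)%_coqZ.

Definition tscale (n : nat) (t : triple) := iter n tmulx t.
Definition tunscale (n : nat) (t : triple) := iter n tdivx t.

(* A state [(k, c)] encodes F `&` (c + q^k F).  Splitting the first factor by
   z = q^j (z' - d) leads, after rescaling the coarser of the two factors to F,
   to a new state; the pair [(e, t)] records the similarity z = q^e z' + t. *)
Definition state := (nat * triple)%type.
Definition similarity := (nat * triple)%type.

Definition transition (j : nat) (d : triple) (s : state) : state * similarity :=
  let: (k, c) := s in
  if (j <= k)%N then ((k - j, tadd (tunscale j c) d)%N, (j, topp (tscale j d)))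
  else ((j - k, topp (tadd (tunscale k c) (tscale (j - k) d)))%N, (k, c)).

Definition transitions (s : state) : seq (state * similarity) :=
  [:: transition 2 (tri 0 0 0) s; transition 3 (tri 1 0 0) s].

(* For rho in ]1.32, 1.33[, tests with two-digit bounds whether
   |c|^2 = A + B rho + C rho^2 exceeds (1.91 (1 + |q|^k))^2. *)
Definition sqnorm_coef (t : triple) : triple :=
  let: (a, b, c) := t in
  tri (a * a - b * b + c * c + (a * c + a * c) + b * c) (c * c + a * b)
      (b * b - c * c - a * c).

Definition far (s : state) : bool :=
  let: (k, t) := s in let: (A, B, C) := sqnorm_coef t in
  let K := match k with
           | 0%N => Some 15 | 1%N => Some 13 | 2%N => Some 12 | 3%N => Some 11
           | _ => None
           end%coqZ in
  if K is Some K then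
    (100 * K <? 100 * A + (if 0 <=? B then 132 else 133) * B
                        + (if 0 <=? C then 175 else 176) * C)%coqZ
  else false.

(** A certificate of emptiness: every branch of the subdivision becomes [far] within [n] steps.
    Nested conditionals let call-by-value evaluation skip the second branch. *)
Fixpoint dead (n : nat) (s : state) : bool :=
  if far s then true
  else if n is n'.+1 then
    if dead n' (transition 2 (tri 0 0 0) s).1 then dead n' (transition 3 (tri 1 0 0) s).1
    else false
  else false.

Definition sim_comp (f g : similarity) : similarity :=
  (f.1 + g.1, tadd (tscale f.1 g.2) f.2)%N.

(** [stX] and [stY] are the states at which the expansion halts: the neighbour intersections lead
    into them, and they lead only to themselves and each other. *)
Definition stX : state := (1, tri 0 (-1) 0)%N.
Definition stY : state := (1, tri 1 0 0)%N.

Fixpoint expand (n : nat) (s : state) : seq (state * similarity) :=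
  if n is n'.+1 then
    if (s == stX) || (s == stY) then [:: (s, (0, tri 0 0 0)%N)]
    else if dead 14 s then [::]
    else [seq (r.1, sim_comp p.2 r.2) | p <- transitions s, r <- expand n' p.1]
  else [:: (s, (0, tri 0 0 0)%N)].

Lemma expandS n s : expand n.+1 s =
  if (s == stX) || (s == stY) then [:: (s, (0, tri 0 0 0)%N)]
  else if dead 14 s then [::]
  else [seq (r.1, sim_comp p.2 r.2) | p <- transitions s, r <- expand n p.1].
Proof. by []. Qed.

(** A first subdivision is forced here, because [expand] returns [stX] and [stY] unchanged. *)
Definition expand1 (s : state) : seq (state * similarity) :=
  [seq (r.1, sim_comp p.2 r.2) | p <- transitions s, r <- expand 12 p.1].

(** Coordinates on the triples with [a + c = 0], that is, on the lattice [Xi]. *)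
Definition height0 (u v : Z) : triple := tri v u (- v).

Definition small_Z : seq Z := [:: -5; -4; -3; -2; -1; 0; 1; 2; 3; 4; 5]%coqZ.

Lemma small_neighbors : all (fun u => all (fun v =>
    if (u == 0) && (v == 0) then true
    else all (fun p : state * similarity => (p.1 == stX) || (p.1 == stY))
           (expand 12 (0%N, height0 u v)))
  small_Z) small_Z.
Proof. by vm_compute. Qed.

Lemma expand1_X : expand1 stX =
  [:: (stY, (1, tri 0 (-1) 0)%N); (stX, (4, tri 0 0 (-1))%N)].
Proof. by vm_compute. Qed.

Lemma expand1_Y : expand1 stY =
  [:: (stX, (8, tri (-1) 3 (-2))%N); (stY, (5, tri 1 0 0)%N)].
Proof. by vm_compute. Qed.

(** The tile at [1 - q^2] meets [F] in a single copy of [X], which later supplies the lower bound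
    for the dimension. *)
Lemma expand_neighbor : expand 12 (0%N, tri 1 0 (-1)) =
  [:: (stX, (3, tri 1 (-1) 0)%N)].
Proof. by vm_compute. Qed.

Definition pull (K : fieldType) (x : K) (f : similarity) (z : K) : K :=
  (z - tev x f.2) / x ^+ f.1.

Lemma pull_id (K : fieldType) (x z : K) : pull x (0%N, tri 0 0 0) z = z.
Proof. by rewrite /pull /tev/= !zr0 !mul0r !addr0 subr0 expr0 divr1. Qed.

Lemma pull_comp (K : fieldType) (x : K) (x3 : x ^+ 3 = x - 1) f g z :
  pull x (sim_comp f g) z = pull x g (pull x f z).
Proof.
rewrite /pull /sim_comp /= tev_add tev_mulx_iter// exprD.
have x0 := cubic_root_neq0 x3.
have := expf_neq0 f.1 x0; have := expf_neq0 g.1 x0.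
move: (x ^+ f.1) (x ^+ g.1) => a b b0 a0.
by field; rewrite a0 b0.
Qed.

Lemma zr_le (K : numDomainType) (a b : Z) : Z.le a b -> zr K a <= zr K b.
Proof. by move=> ab; rewrite /zr ler_int; lia. Qed.

Lemma zr_lt (K : numDomainType) (a b : Z) : Z.lt a b -> zr K a < zr K b.
Proof. by move=> ab; rewrite /zr ltr_int; lia. Qed.

(** * The plastic number and squared moduli in Z[q] *)

Section Plastic.
Variables (R : realType) (q : R[i]).
Hypotheses (q3 : q ^+ 3 = q - 1) (qIm : complex.Im q != 0).

Local Notation rho := (2 * complex.Re q).
Local Notation r := (normc q).

Lemma plastic_rho3 : rho ^+ 3 = rho + 1.
Proof. by have [] := plastic_of_complex_root q3 qIm. Qed.

Lemma plastic_normc2 : r ^+ 2 = rho ^+ 2 - 1.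
Proof. by have [] := plastic_of_complex_root q3 qIm. Qed.

Lemma plastic_q0 : q != 0. Proof. exact: cubic_root_neq0 q3. Qed.

Lemma plastic_normc_gt0 : 0 < r. Proof. exact: normc_gt0 plastic_q0. Qed.

Lemma plastic_rho_bounds : 132 / 100 < rho < 133 / 100 /\ 175 / 100 < rho ^+ 2 < 176 / 100.
Proof.
have /andP[h1 h2] := plastic_bounds plastic_rho3.
have a1 : 1324 / 1000 < rho by lra.
have a2 : rho < 1325 / 1000 by lra.
by split; [lra|apply/andP; split; nra].
Qed.

Lemma plastic_normc_lt : r < 869 / 1000.
Proof.
have /andP[h1 h2] := plastic_bounds plastic_rho3.
have a2 : rho < 13248 / 10000 by lra.
have := plastic_normc2; have := plastic_normc_gt0; nra.
Qed.

Lemma plastic_normc2_rho : r ^+ 2 * rho = 1.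
Proof. by rewrite plastic_normc2; have := plastic_rho3; lra. Qed.

(** The squared modulus is symmetric in [q] and its complex conjugate, whose sum is [rho] and whose
    product is [rho^2 - 1]; so it lies in Z[rho]. *)
Lemma normc_tev_sqr t : let: (A, B, C) := sqnorm_coef t in
  normc (tev q t) ^+ 2 = zr R A + zr R B * rho + zr R C * rho ^+ 2.
Proof.
have := plastic_normc2; have r3 := plastic_rho3.
case: t => -[a b] c; rewrite /sqnorm_coef /tri /tev.
have zC z : zr R[i] z = (zr R z)%:C by rewrite /zr rmorph_int.
rewrite !zC !normc_sqr; move: r3; case: (q) => x y /=; rewrite !expr2 /= => r3 e.
rewrite !(zrD, zrB, zrM).
move: (zr R a) (zr R b) (zr R c) => {}a {}b {}c.
have y2 : y * y = 2 * x * (2 * x) - 1 - x * x by lra.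
have x3 : 8 * x ^+ 3 = 2 * x + 1 by lra.
rewrite !(mul0r, mulr0, subr0, addr0, add0r).
have -> : (b * y + c * (x * y + y * x)) * (b * y + c * (x * y + y * x)) =
  (y * y) * (b + 2 * c * x) ^+ 2 by ring.
rewrite y2.
apply/eqP; rewrite -subr_eq0; apply/eqP.
transitivity ((2 * c ^+ 2 * x + b * c) * (8 * x ^+ 3 - (2 * x + 1))); first by ring.
by rewrite x3 subrr mulr0.
Qed.

End Plastic.

(** * Subdivision of the tile and empty intersections *)

Section Tile.
Variables (R : realType) (q : R[i]).
Hypotheses (q3 : q ^+ 3 = q - 1) (qIm : complex.Im q != 0).
Variable F : set R[i]^o.
Hypotheses (Fcompact : compact F) (Fne : F !=set0).
Hypothesis Fsplit : forall z, F z <-> F (z / q ^+ 2) \/ F (z / q ^+ 3 + 1).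

Local Notation rho := (2 * complex.Re q).
Local Notation r := (normc q).
Local Notation pull := (pull q).
Let q0 : q != 0 := plastic_q0 q3.
Let r0 : 0 < r := plastic_normc_gt0 q3.
Let rlt : r < 869 / 1000 := plastic_normc_lt q3 qIm.
Let r_lt1 : r < 1. Proof. by have := rlt; lra. Qed.

(** The radius 1.91 is slightly above [|q|^3 / (1 - |q|^3)], so both branches preserve that disc.
    Any excess over it shrinks by at least [|q|^2] at each subdivision, hence vanishes. *)
Lemma tile_radius z : F z -> normc z <= 191 / 100.
Proof.
have [M M0 FM] := compact_normc_bounded Fcompact.
have r2 : 0 < r ^+ 2 by rewrite exprn_gt0.
have r21 : r ^+ 2 < 1 by rewrite expr_lt1// ltW.
have r3le : r ^+ 3 <= (869 / 1000) ^+ 3.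
  by apply: lerXn2r; [rewrite nnegrE ltW|rewrite nnegrE; lra|exact: ltW].
have bound n : forall w, F w -> normc w <= 191 / 100 + (r ^+ 2) ^+ n * M.
  elim: n => [|n IH] w.
    by move=> /FM; rewrite expr0 mul1r => /le_trans; apply; rewrite lerDr; lra.
  have t0 : 0 <= (r ^+ 2) ^+ n * M by rewrite mulr_ge0 ?exprn_ge0// ltW.
  rewrite Fsplit => -[] /IH; move: t0; rewrite [_ ^+ n.+1]exprS -(mulrA _ _ M);
    move: (_ ^+ n * M) => t t0 wn.
    rewrite -[w](divfK (expf_neq0 2 q0)) Normc.normcM normcX mulrC.
    apply: (le_trans (ler_wpM2l (ltW r2) wn)).
    by rewrite mulrDr lerD2r; apply: ler_piMl; [lra|exact: ltW].
  rewrite (_ : w = q ^+ 3 * ((w / q ^+ 3 + 1) - 1)); last by field.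
  rewrite Normc.normcM normcX.
  have h : normc ((w / q ^+ 3 + 1) - 1) <= 291 / 100 + t.
    by apply: le_trans (normcD _ _) _; rewrite normcN Normc.normc1; lra.
  apply: (le_trans (ler_wpM2l (exprn_ge0 3 (ltW r0)) h)).
  rewrite mulrDr lerD//; first by lra.
  by rewrite ler_wpM2r// exprSr ler_piMr ?(ltW r2)// ltW.
move=> Fz; rewrite leNgt; apply/negP => h.
have e0 : 0 < (normc z - 191 / 100) / 2 by lra.
have [N /(_ N (leqnn N)) Ne] := geometric_small M (ltW r2) r21 e0.
by have := bound N _ Fz; lra.
Qed.

Definition piece (s : state) (z : R[i]) : Prop :=
  F z /\ F ((z - tev q s.2) / q ^+ s.1).

Lemma transition_spec j d s z :
  F (z / q ^+ j + tev q d) /\ F ((z - tev q s.2) / q ^+ s.1) <->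
  piece (transition j d s).1 (pull (transition j d s).2 z).
Proof.
case: s => k c; rewrite /transition /piece /pull.
have qj : q ^+ j != 0 by rewrite expf_neq0.
have qk : q ^+ k != 0 by rewrite expf_neq0.
case: leqP => [jk|/ltnW jk] /=.
  rewrite tev_opp tev_mulx_iter// tev_add tev_divx_iter//.
  have e1 : z / q ^+ j + tev q d = (z - - (q ^+ j * tev q d)) / q ^+ j by field.
  have e2 : ((z - - (q ^+ j * tev q d)) / q ^+ j - (tev q c / q ^+ j + tev q d)) /
      q ^+ (k - j) = (z - tev q c) / q ^+ k.
    rewrite -{2}(subnKC jk) exprD.
    have qkj : q ^+ (k - j) != 0 by rewrite expf_neq0.
    by field; rewrite qkj qj.
  by rewrite e1 e2.
rewrite tev_opp tev_add tev_divx_iter// tev_mulx_iter//.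
have -> : ((z - tev q c) / q ^+ k - - (tev q c / q ^+ k + q ^+ (j - k) * tev q d)) /
      q ^+ (j - k) = z / q ^+ j + tev q d.
  rewrite -{3}(subnKC jk) exprD.
  have qkj : q ^+ (j - k) != 0 by rewrite expf_neq0.
  by field; rewrite qkj qk.
by split=> [[? ?]|[? ?]]; split.
Qed.

Lemma piece_transitions s z :
  piece s z <-> exists2 p, p \in transitions s & piece p.1 (pull p.2 z).
Proof.
have t0 : tev q (tri 0 0 0) = 0 by rewrite /tev/= !zr0 !mul0r !addr0.
have t1 : tev q (tri 1 0 0) = 1 by rewrite /tev/= !zr0 !zr1 !mul0r !addr0.
have := transition_spec 2 (tri 0 0 0) s z; have := transition_spec 3 (tri 1 0 0) s z.
rewrite t0 t1 addr0 => h3 h2; rewrite {1}/piece Fsplit /transitions.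
split=> [[[F2|F3] Fs]|[p]].
- by exists (transition 2 (tri 0 0 0) s); [rewrite inE eqxx|apply/h2].
- by exists (transition 3 (tri 1 0 0) s); [rewrite !inE eqxx orbT|apply/h3].
- by rewrite !inE => /orP[] /eqP -> => [/h2|/h3] [? ?]; split; tauto.
Qed.

Lemma far_empty s z : far s -> ~ piece s z.
Proof.
case: s => k t; rewrite /far => ft [Fz Fw].
have qk : q ^+ k != 0 by rewrite expf_neq0.
have n1 := tile_radius Fz; have n2 := tile_radius Fw.
have tn : normc (tev q t) <= 191 / 100 * (1 + r ^+ k).
  rewrite [tev q t](_ : _ = z - (z - tev q t) / q ^+ k * q ^+ k); last first.
    by rewrite divfK// subKr.
  rewrite (le_trans (normcD _ _))// normcN Normc.normcM normcX.
  by rewrite mulrDr mulr1 lerD// ler_wpM2r// exprn_ge0// ltW.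
have tn2 : normc (tev q t) ^+ 2 <= (191 / 100) ^+ 2 * (1 + r ^+ k) ^+ 2.
  rewrite -exprMn; apply: lerXn2r; [exact: normc_ge0| |exact: tn].
  exact: le_trans (normc_ge0 _) tn.
have [/andP[l1 u1] /andP[l2 u2]] := plastic_rho_bounds q3 qIm.
have := normc_tev_sqr q3 qIm t; move: ft.
case: (sqnorm_coef t) => -[A B] C.
set K := (X in if X is Some _ then _ else _); case EK : K => [K'|//].
move=> ft e; rewrite e in tn2.
(* The sign of the coefficient decides which bound of [rho] gives a lower bound of the product. *)
have hB : zr R (if (0 <=? B)%coqZ then 132%coqZ else 133%coqZ) * zr R B <=
    100 * (zr R B * rho).
  case: Z.leb_spec => hB.
    have h : 0 <= zr R B by exact: (@zr_le R 0%coqZ B hB).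
    have -> : zr R 132%coqZ = 132 by []; nra.
  have h : zr R B < 0 by exact: (@zr_lt R B 0%coqZ hB).
  have -> : zr R 133%coqZ = 133 by []; nra.
have hC : zr R (if (0 <=? C)%coqZ then 175%coqZ else 176%coqZ) * zr R C <=
    100 * (zr R C * rho ^+ 2).
  case: Z.leb_spec => hC.
    have h : 0 <= zr R C by exact: (@zr_le R 0%coqZ C hC).
    have -> : zr R 175%coqZ = 175 by []; nra.
  have h : zr R C < 0 by exact: (@zr_lt R C 0%coqZ hC).
  have -> : zr R 176%coqZ = 176 by []; nra.
have {ft} : zr R (100 * K')%coqZ < zr R (100 * A +
    (if (0 <=? B)%coqZ then 132%coqZ else 133%coqZ) * B +
    (if (0 <=? C)%coqZ then 175%coqZ else 176%coqZ) * C)%coqZ.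
  by apply: zr_lt; apply/Z.ltb_lt.
rewrite !(zrD, zrM) (_ : zr R 100 = 100)// => ft.
have : zr R K' < (191 / 100) ^+ 2 * (1 + r ^+ k) ^+ 2 by lra.
have rk (m : nat) (x : R) : r ^+ m <= x -> (1 + r ^+ m) ^+ 2 <= (1 + x) ^+ 2.
  move=> h; have := exprn_ge0 m (ltW r0) => h'.
  by apply: lerXn2r; rewrite ?nnegrE; [lra|lra|rewrite lerD2l].
apply/negP; rewrite -leNgt; move: EK; rewrite /K.
have r2 : r ^+ 2 <= 756 / 1000 by have := rlt; have := r0; nra.
have r3 : r ^+ 3 <= 657 / 1000 by rewrite exprS; have := rlt; have := r0; nra.
have rk' : forall x : R, r ^+ k <= x -> (1 + r ^+ k) ^+ 2 <= (1 + x) ^+ 2 by exact: rk.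
(* The entries 15, 13, 12, 11 of [far] are upper bounds of [(1.91 (1 + |q|^k))^2] for [k] from 0 to
   3. *)
case: k {qk tn tn2 n2 Fw K rk} rk' => [|[|[|[|k]]]] //= rk [<-].
- by rewrite (_ : zr R 15 = 15)// expr0; lra.
- by have := rk _ (ltW rlt); rewrite (_ : zr R 13 = 13)// expr1; lra.
- by have := rk _ r2; rewrite (_ : zr R 12 = 12)//; lra.
- by have := rk _ r3; rewrite (_ : zr R 11 = 11)//; lra.
Qed.

Lemma dead_empty n s z : dead n s -> ~ piece s z.
Proof.
elim: n s z => [|n IH] s z /=; case: ifP => [/far_empty//|_] //.
case: ifP => // d2 d3 /piece_transitions[p].
by rewrite !inE => /orP[] /eqP ->; apply: IH.
Qed.

End Tile.

(** * Neighbour intersections and the self-similar set X *)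

Section Neighbors.
Variables (R : realType) (q : R[i]).
Hypotheses (q3 : q ^+ 3 = q - 1) (qIm : complex.Im q != 0).
Variable F : set R[i]^o.
Hypotheses (Fcompact : compact F).
Hypothesis Fsplit : forall z, F z <-> F (z / q ^+ 2) \/ F (z / q ^+ 3 + 1).

Local Notation rho := (2 * complex.Re q).
Local Notation r := (normc q).
Local Notation piece := (piece q F).
Local Notation pull := (pull q).
Let q0 : q != 0 := plastic_q0 q3.
Let r0 : 0 < r := plastic_normc_gt0 q3.
Let rlt : r < 869 / 1000 := plastic_normc_lt q3 qIm.
Let r_lt1 : r < 1. Proof. by have := rlt; lra. Qed.
Let tile_radius := tile_radius q3 qIm Fcompact Fsplit.
Let dead_empty := dead_empty q3 qIm Fcompact Fsplit.
Let piece_transitions := piece_transitions q3 Fsplit.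
Let pull_comp := @pull_comp _ _ q3.

(** Valid for any fuel: pruning drops only empty pieces, and exhausted fuel returns the state
    itself. *)
Lemma expandP n s z :
  piece s z <-> exists2 p, p \in expand n s & piece p.1 (pull p.2 z).
Proof.
have idP s' z' : piece s' z' <-> exists2 p, p \in [:: (s', (0%N, tri 0 0 0))] &
    piece p.1 (pull p.2 z').
  split=> [Ss|[p]]; first by exists (s', (0%N, tri 0 0 0)); rewrite ?inE// pull_id.
  by rewrite inE => /eqP -> /=; rewrite pull_id.
elim: n s z => [|n IH] s z; first exact: idP.
rewrite expandS; case: ifP => _; first exact: idP.
case: ifP => [ds|_]; first by split=> [/(dead_empty ds)|[]].
split=> [/piece_transitions[p pt /IH[p' pp' S']]|[_ /allpairsPdep[p [p' [pt pp' ->]]]]].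
  exists (p'.1, sim_comp p.2 p'.2); last by rewrite /= pull_comp.
  by apply/allpairsPdep; exists p, p'.
rewrite /= pull_comp => S'; apply/piece_transitions; exists p => //.
by apply/IH; exists p'.
Qed.

Lemma expand1P s z :
  piece s z <-> exists2 p, p \in expand1 s & piece p.1 (pull p.2 z).
Proof.
split=> [/piece_transitions[p pt /(expandP 12)[p' pp' S']]|].
  exists (p'.1, sim_comp p.2 p'.2); last by rewrite /= pull_comp.
  by apply/allpairsPdep; exists p, p'.
move=> [_ /allpairsPdep[p [p' [pt pp' ->]]]].
rewrite /= pull_comp => S'; apply/piece_transitions; exists p => //.
by apply/(expandP 12); exists p'.
Qed.

Lemma pieceX_split z : piece stX z <->
  piece stY (pull (1, tri 0 (-1) 0)%N z) \/ piece stX (pull (4, tri 0 0 (-1))%N z).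
Proof.
rewrite expand1P expand1_X; split=> [[p]|[h|h]].
- by rewrite !inE => /orP[] /eqP -> /=; [left|right].
- by eexists; [apply: mem_head|].
- by exists (stX, (4, tri 0 0 (-1))%N); rewrite ?inE ?eqxx ?orbT.
Qed.

Lemma pieceY_split z : piece stY z <->
  piece stX (pull (8, tri (-1) 3 (-2))%N z) \/ piece stY (pull (5, tri 1 0 0)%N z).
Proof.
rewrite expand1P expand1_Y; split=> [[p]|[h|h]].
- by rewrite !inE => /orP[] /eqP -> /=; [left|right].
- by eexists; [apply: mem_head|].
- by exists (stY, (5, tri 1 0 0)%N); rewrite ?inE ?eqxx ?orbT.
Qed.

(* Write [X = H Y `|` G X] and [Y = L X `|` K Y] for the two decompositions above.
   The similarity [T : z |-> q^4 z + q - q^2] satisfies [K = T H] and [L = T G],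
   so [Y = T (H Y `|` G X) = T X]. *)
Lemma pieceY_X z : piece stY z <-> piece stX (pull (4, tri 0 1 (-1))%N z).
Proof.
have := pieceX_split (pull (4, tri 0 1 (-1))%N z); rewrite -!pull_comp.
rewrite (_ : sim_comp _ (1, _)%N = (5, tri 1 0 0)%N); last by vm_compute.
rewrite (_ : sim_comp _ (4, _)%N = (8, tri (-1) 3 (-2))%N); last by vm_compute.
by move=> ->; rewrite pieceY_split; exact: or_comm.
Qed.

(** Substitute [Y = T X] into the decomposition of [X]; the remaining ratios are [|q|^4] and
    [|q|^5]. *)
Lemma pieceX_selfsimilar z : piece stX z <->
  piece stX (pull (4, tri 0 0 (-1))%N z) \/ piece stX (pull (5, tri 1 (-2) 1)%N z).
Proof.
rewrite pieceX_split pieceY_X -pull_comp.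
rewrite (_ : sim_comp _ _ = (5, tri 1 (-2) 1)%N); last by vm_compute.
exact: or_comm.
Qed.

Lemma pieceX_neighbor z :
  piece stX (pull (3, tri 1 (-1) 0)%N z) -> piece (0%N, tri 1 0 (-1)) z.
Proof.
by move=> h; apply/(expandP 12); rewrite expand_neighbor; eexists; [apply: mem_head|].
Qed.

Lemma pieceX_null s : 0 < s -> r `^ (4 * s) + r `^ (5 * s) < 1 ->
  ball_null s (piece stX).
Proof.
move=> s0 rs; apply: (@ball_null_selfsimilar _ _ _ (q ^+ 4)
    (tev q (tri 0 0 (-1))) (q ^+ 5) (tev q (tri 1 (-2) 1)) (191 / 100)) => //.
- by move=> z [/tile_radius].
- by rewrite expf_neq0.
- by rewrite expf_neq0.
- by rewrite normcX exprn_ilt1// ltW.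
- by rewrite normcX exprn_ilt1// ltW.
- by rewrite !normcX -!powR_mulrn ?(ltW r0)// -!powRrM.
- by move=> z /pieceX_selfsimilar.
Qed.

Lemma pull_null s (A : set R[i]) f : ball_null s A -> ball_null s (fun z => A (pull f z)).
Proof.
move=> nA; apply: (@ball_null_affine _ _ _ A (q ^- f.1) (- tev q f.2 / q ^+ f.1)) => //.
  by rewrite invr_neq0// expf_neq0.
by move=> z; rewrite /pull (_ : (_ - _) / _ = q ^- f.1 * z + - tev q f.2 / q ^+ f.1) // mulrBl mulNr mulrC.
Qed.

Lemma normc_lattice_sqr u v :
  normc (tev q (height0 u v)) ^+ 2 =
  (rho ^+ 2 - 1) * zr R u ^+ 2 + rho * zr R v ^+ 2 + (rho - 1) * (zr R u * zr R v).
Proof.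
have -> : normc (tev q (height0 u v)) ^+ 2 =
  zr R (v * v - u * u + - v * - v + (v * - v + v * - v) + u * - v)%coqZ +
  zr R (- v * - v + v * u)%coqZ * rho +
  zr R (u * u - - v * - v - v * - v)%coqZ * rho ^+ 2.
  exact: normc_tev_sqr q3 qIm (height0 u v).
by rewrite !(zrD, zrB, zrM, zrN); ring.
Qed.

Lemma lattice_normc_ge u v :
  1 / 2 * zr R u ^+ 2 + 1 / 2 * zr R v ^+ 2 <= normc (tev q (height0 u v)) ^+ 2.
Proof.
have [/andP[l1 u1] /andP[l2 u2]] := plastic_rho_bounds q3 qIm.
rewrite normc_lattice_sqr; move: (rho) l1 u1 l2 u2 => p l1 u1 l2 u2.
move: (zr R u) (zr R v) => x y.
(* The mixed term is absorbed through [2 x y = (x + y)^2 - x^2 - y^2]; as [p < 1.33] the loss in the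
   squares is small. *)
have h1 : 0 <= (p - 1) * (x + y) ^+ 2 by rewrite mulr_ge0 ?sqr_ge0//; lra.
have h2 : 0 <= (p ^+ 2 - 175 / 100) * x ^+ 2.
  by apply: mulr_ge0; [rewrite subr_ge0 ltW|exact: sqr_ge0].
have h3 : 0 <= (p - 132 / 100) * y ^+ 2.
  by apply: mulr_ge0; [rewrite subr_ge0 ltW|exact: sqr_ge0].
have h4 : 0 <= (133 / 100 - p) * (x ^+ 2 + y ^+ 2).
  by apply: mulr_ge0; [lra|rewrite addr_ge0 ?sqr_ge0].
by have := sqr_ge0 x; have := sqr_ge0 y; lra.
Qed.

(** A coordinate outside [small_Z] is at least 6 in modulus, so the squared norm is at least 18.
    Tiles that meet have offset at most [2 * 1.91], whose square is below 15. *)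
Lemma lattice_far u v : u \notin small_Z \/ v \notin small_Z ->
  15 < normc (tev q (height0 u v)) ^+ 2.
Proof.
have big (w : Z) : w \notin small_Z -> 36 <= zr R w ^+ 2.
  move=> wS; have : Z.le w (-6)%coqZ \/ Z.le 6%coqZ w.
    by move: wS; rewrite !inE -(rwP negP) -!(rwP orP) -!(rwP eqP); lia.
  move=> [/(@zr_le R)|/(@zr_le R)].
    by rewrite (_ : zr R (-6)%coqZ = - 6)// => h; nra.
  by rewrite (_ : zr R 6%coqZ = 6)// => h; nra.
have := lattice_normc_ge u v; have := sqr_ge0 (zr R u); have := sqr_ge0 (zr R v).
by move=> h1 h2 h3 [/big|/big]; lra.
Qed.

Lemma lattice_far_empty u v z : u \notin small_Z \/ v \notin small_Z ->
  ~ piece (0%N, height0 u v) z.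
Proof.
move=> /lattice_far uv [/tile_radius h1]; rewrite expr0 divr1 => /tile_radius h2.
have : normc (tev q (height0 u v)) <= 191 / 50.
  rewrite -[tev _ _](subKr z) (le_trans (normcD _ _))// normcN.
  by lra.
move=> h3; move: uv; apply/negP; rewrite -leNgt.
apply: (@le_trans _ _ ((191 / 50) ^+ 2)); last by lra.
apply: lerXn2r; [exact: normc_ge0| |exact: h3].
exact: le_trans (normc_ge0 _) h3.
Qed.

(** Outside [small_Z] the piece is empty. Inside, the computed expansion consists of copies of [X]
    and [Y], and [Y] is itself a copy of [X]. *)
Lemma neighbor_null s u v : ball_null s (piece stX) -> ~~ ((u == 0) && (v == 0)) ->
  ball_null s (piece (0%N, height0 u v)).
Proof.
move=> nX uv0.
have nY : ball_null s (piece stY).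
  by apply: ball_null_sub (pull_null (4, tri 0 1 (-1))%N nX) => z /pieceY_X.
have [uS|uS] := boolP (u \in small_Z); last first.
  apply: (@ball_null_sub _ _ _ set0) => [z|]; last exact: ball_null0.
  by move=> /lattice_far_empty h; apply: h; left.
have [vS|vS] := boolP (v \in small_Z); last first.
  apply: (@ball_null_sub _ _ _ set0) => [z|]; last exact: ball_null0.
  by move=> /lattice_far_empty h; apply: h; right.
have /allP/(_ u uS)/allP/(_ v vS) := small_neighbors.
rewrite (negPf uv0) => /allP exp.
apply: (@ball_null_sub _ _ _ (fun z => exists2 p, p \in expand 12 (0%N, height0 u v) &
    piece p.1 (pull p.2 z))); first by move=> z /(expandP 12).
elim: (expand _ _) exp => [_|p l IH exp].
  by apply: (@ball_null_sub _ _ _ set0) => [z []|]; last exact: ball_null0.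
apply: (@ball_null_sub _ _ _ ((fun z => piece p.1 (pull p.2 z)) `|`
  (fun z => exists2 p, p \in l & piece p.1 (pull p.2 z)))).
  move=> z [p']; rewrite inE => /orP[/eqP -> h|pl h]; first by left.
  by right; exists p'.
apply: ball_nullU; last by apply: IH => p' pl; apply: exp; rewrite inE pl orbT.
by apply: pull_null; have /orP[/eqP -> |/eqP ->] := exp p (mem_head _ _).
Qed.

End Neighbors.

(** * Covering of the plane and boundary of the tile *)

Definition tone : triple := tri 1 0 0.

(* The lattice [Xi] is the kernel of the height, so [Xi + F] contains a given
   element of Z[q] as soon as [F] contains one with the same height. *)
Definition height (t : triple) : Z := let: (a, _, c) := t in Z.add a c.

Lemma height_add s t : height (tadd s t) = Z.add (height s) (height t).
Proof. by case: s => -[a b] c; case: t => -[a' b'] c' /=; lia. Qed.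

Lemma height_opp t : height (topp t) = Z.opp (height t).
Proof. by case: t => -[a b] c /=; lia. Qed.

(** Up to the sign [(-1)^n], the heights of the powers of [q] are therefore Padovan numbers. *)
Lemma height_scale3 n : height (tscale n.+3 tone) =
  Z.sub (height (tscale n.+1 tone)) (height (tscale n tone)).
Proof. by rewrite /tscale !iterS; case: (iter _ _ _) => -[a b] c /=; lia. Qed.

(* [reach n y]: the map w |-> q^n w + y is a composition of the two branches
   w |-> q^2 w and w |-> q^3 (w - 1). *)
Inductive reach : nat -> triple -> Prop :=
| reach0 : reach 0 (tri 0 0 0)
| reachL n y : reach n y -> reach n.+2 y
| reachR n y : reach n y -> reach n.+3 (tadd y (topp (tscale n.+3 tone))).

(** With [D_n] the Padovan number of level [n], the interval is [[1, D_n]] for odd [n] and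
    [[1 - D_n, 0]] for even [n]. Level [n + 3] inherits that of level [n + 1] by the left branch and
    a translate of that of level [n] by the right one; the two are adjacent and fill the new
    interval. *)
Lemma reach_heights n m :
  (if odd n then Z.le 1 m /\ Z.le m (Z.opp (height (tscale n tone)))
   else Z.le 1 (Z.add m (height (tscale n tone))) /\ Z.le m 0) ->
  exists2 y, reach n y & height y = m.
Proof.
(* The induction carries three consecutive levels, the order of the recurrence. *)
move: m; have : (forall m, (if odd n then Z.le 1 m /\ Z.le m (Z.opp (height (tscale n tone)))
   else Z.le 1 (Z.add m (height (tscale n tone))) /\ Z.le m 0) ->
  exists2 y, reach n y & height y = m) /\
  (forall m, (if odd n.+1 then Z.le 1 m /\ Z.le m (Z.opp (height (tscale n.+1 tone)))
   else Z.le 1 (Z.add m (height (tscale n.+1 tone))) /\ Z.le m 0) ->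
  exists2 y, reach n.+1 y & height y = m) /\
  (forall m, (if odd n.+2 then Z.le 1 m /\ Z.le m (Z.opp (height (tscale n.+2 tone)))
   else Z.le 1 (Z.add m (height (tscale n.+2 tone))) /\ Z.le m 0) ->
  exists2 y, reach n.+2 y & height y = m); last by case.
elim: n => [|n [IH0 [IH1 IH2]]].
  split; [|split] => m /= mh.
  - by exists (tri 0 0 0); [exact: reach0|move=> /=; lia].
  - by lia.
  - by exists (tri 0 0 0); [exact: reachL reach0|move=> /=; lia].
split=> //; split=> // m; rewrite height_scale3 /= !negbK => mh.
have heightR y : height (tadd y (topp (tscale n.+3 tone))) =
    Z.sub (height y) (Z.sub (height (tscale n.+1 tone)) (height (tscale n tone))).
  by rewrite height_add height_opp height_scale3; lia.
have fromL : (if odd n.+1 then Z.le 1 m /\ Z.le m (Z.opp (height (tscale n.+1 tone)))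
   else Z.le 1 (Z.add m (height (tscale n.+1 tone))) /\ Z.le m 0) ->
   exists2 y, reach n.+3 y & height y = m.
  by move=> /IH1[y ry hy]; exists y => //; exact: reachL.
have fromR : (if odd n then Z.le 1 (Z.add m (height (tscale n.+3 tone))) /\ Z.le (Z.add m (height (tscale n.+3 tone))) (Z.opp (height (tscale n tone)))
   else Z.le 1 (Z.add (Z.add m (height (tscale n.+3 tone))) (height (tscale n tone))) /\ Z.le (Z.add m (height (tscale n.+3 tone))) 0) ->
   exists2 y, reach n.+3 y & height y = m.
  move=> /IH0[y ry hy]; exists (tadd y (topp (tscale n.+3 tone))); first exact: reachR.
  by rewrite heightR hy height_scale3; lia.
move: fromL fromR; rewrite height_scale3 /=; move: mh.
move: (height (tscale n.+1 tone)) (height (tscale n tone)) => a b.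
case: (odd n) => /= mh fL fR.
  have [h|h] := Z.le_gt_cases 1 (Z.add m a); [apply: fL|apply: fR]; lia.
have [h|h] := Z.le_gt_cases m (Z.opp a); [apply: fL|apply: fR]; lia.
Qed.

(** Both parities are needed: odd levels give the positive heights, even levels the others. *)
Lemma height_scale_unbounded (b : bool) k : exists2 n, odd n = b &
  Z.le (Z.of_nat k) (if b then Z.opp (height (tscale n tone)) else height (tscale n tone)).
Proof.
pose D n := if odd n then Z.opp (height (tscale n tone)) else height (tscale n tone).
have D3 n : D n.+3 = Z.add (D n.+1) (D n).
  by rewrite /D height_scale3 /= negbK; case: (odd n) => /=; lia.
have Dpos n : Z.le 1 (D n.+2) /\ Z.le 1 (D n.+3) /\ Z.le 1 (D n.+4).
  elim: n => [|n [h1 [h2 h3]]]; first by vm_compute; do ?split.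
  by split=> //; split=> //; rewrite (D3 n.+2); lia.
have D6 n : Z.le (Z.add (D n.+2) 1) (D n.+2.+4.+2).
  have [h1 [h2 h3]] := Dpos n.
  by rewrite (D3 n.+4.+1) (D3 n.+3) (D3 n.+2); lia.
(* Six more levels keep the parity and increase the Padovan number by at least 1. *)
have Dk j : Z.le (Z.of_nat j) (D (6 * j + 2)%N) /\ Z.le (Z.of_nat j) (D (6 * j + 3)%N).
  elim: j => [|j [h1 h2]]; first by vm_compute; split; case.
  have := D6 (6 * j)%N; have := D6 (6 * j).+1.
  rewrite (_ : (6 * j.+1 + 2 = (6 * j).+2.+4.+2)%N); last by lia.
  rewrite (_ : (6 * j.+1 + 3 = (6 * j).+1.+2.+4.+2)%N); last by lia.
  move: h1 h2; rewrite !addn2 addn3 => h1 h2 h3 h4.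
  by split; lia.
have [h1 h2] := Dk k; case: b.
  exists (6 * k + 3)%N; first by rewrite oddD oddM.
  by move: h2; rewrite /D oddD oddM.
exists (6 * k + 2)%N; first by rewrite oddD oddM.
by move: h1; rewrite /D oddD oddM.
Qed.

Lemma reach_every_height m : exists n y, reach n y /\ height y = m.
Proof.
have [m1|m0] := Z.le_gt_cases 1 m.
  have [n nb hn] := height_scale_unbounded true (Z.to_nat m).
  have [|y ry hy] := @reach_heights n m; first by rewrite nb; lia.
  by exists n, y.
have [n nb hn] := height_scale_unbounded false (Z.to_nat (Z.sub 1 m)).
have [|y ry hy] := @reach_heights n m; first by rewrite nb; lia.
by exists n, y.
Qed.

Lemma bounded_Z (R : realType) (M : R) : exists l : seq Z, forall u, `|zr R u| <= M -> u \in l.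
Proof.
pose N := Num.truncn M.
exists [seq Z.sub (Z.of_nat k) (Z.of_nat N) | k <- iota 0 (2 * N).+1] => u uM.
have uN : Z.le (Z.abs u) (Z.of_nat N).
  have : `|zr R u| < N.+1%:R by apply: le_lt_trans uM _; exact: truncnS_gt.
  rewrite /zr -intr_norm -[N.+1%:R]/((Posz N.+1)%:~R) ltr_int; lia.
by apply/mapP; exists (Z.to_nat (Z.add u (Z.of_nat N))); rewrite ?mem_iota; lia.
Qed.

Section Covering.
Variables (R : realType) (q : R[i]).
Hypotheses (q3 : q ^+ 3 = q - 1) (qIm : complex.Im q != 0).
Variable F : set R[i]^o.
Hypotheses (Fcompact : compact F) (Fne : F !=set0).
Hypothesis Fsplit : forall z, F z <-> F (z / q ^+ 2) \/ F (z / q ^+ 3 + 1).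

Local Notation r := (normc q).
Local Notation piece := (piece q F).
Local Notation xi u v := (tev q (height0 u v)).
Let q0 : q != 0 := plastic_q0 q3.
Let r0 : 0 < r := plastic_normc_gt0 q3.
Let r_lt1 : r < 1. Proof. by have := plastic_normc_lt q3 qIm; lra. Qed.
Let tile_radius := tile_radius q3 qIm Fcompact Fsplit.
Let Fclosed := compact_closed_normc Fcompact.

(** Iterating the contraction from any point of [F] converges to its fixed point, and [F] is
    closed. *)
Lemma tile_fixpoint n a b : (0 < n)%N -> (forall w, F w -> F (q ^+ n * w + b)) ->
  a = q ^+ n * a + b -> F a.
Proof.
move=> n0 Fb ab; apply: Fclosed => e e0; have [x Fx] := Fne.
have rn1 : r ^+ n < 1 by rewrite exprn_ilt1// -?lt0n// ltW.
have iterF k : F (q ^+ (n * k) * (x - a) + a).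
  elim: k => [|k IH]; first by rewrite muln0 expr0 mul1r subrK.
  rewrite (_ : _ + a = q ^+ n * (q ^+ (n * k) * (x - a) + a) + b); first exact: Fb.
  by rewrite mulnS exprD {2}ab; ring.
have e2 : 0 < e / 2 by rewrite divr_gt0.
have [N /(_ N (leqnn N)) Ne] :=
  geometric_small (normc (x - a)) (exprn_ge0 n (ltW r0)) rn1 e2.
exists (q ^+ (n * N) * (x - a) + a) => //.
rewrite addrK Normc.normcM normcX exprM (le_lt_trans Ne)//.
by rewrite ltr_pdivrMr// ltr_pMr// ltr1n.
Qed.

Lemma tile_branchL w : F w -> F (q ^+ 2 * w).
Proof. by move=> Fw; apply/Fsplit; left; rewrite mulrC mulKf// expf_neq0. Qed.

Lemma tile_branchR w : F w -> F (q ^+ 3 * (w - 1)).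
Proof.
by move=> Fw; apply/Fsplit; right; rewrite mulrC mulKf ?expf_neq0// subrK.
Qed.

Lemma tile0 : F 0.
Proof.
apply: (@tile_fixpoint 2 _ 0) => // [w Fw|]; last by rewrite mulr0 addr0.
by rewrite addr0; exact: tile_branchL.
Qed.

Lemma reach_tile n y w : reach n y -> F w -> F (q ^+ n * w + tev q y).
Proof.
move=> ry; elim: ry w => [|{}n {}y _ IH|{}n {}y _ IH] w Fw.
- by rewrite /tev /= !zr0 !mul0r !addr0 expr0 mul1r.
- rewrite (_ : q ^+ n.+2 * w = q ^+ n * (q ^+ 2 * w)); last by rewrite mulrA -exprD addn2.
  by apply: IH; exact: tile_branchL.
- rewrite tev_add tev_opp tev_mulx_iter//.
  have -> : tev q tone = 1 by rewrite /tev /= !zr0 zr1 !mul0r !addr0.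
  rewrite (_ : _ + _ = q ^+ n * (q ^+ 3 * (w - 1)) + tev q y); last first.
    by rewrite -addn3 exprD; ring.
  by apply: IH; exact: tile_branchR.
Qed.

(** Since [0] is in [F], so are the translation parts of all branch words. One of them has the
    height of [x], and then the difference lies in the lattice. *)
Lemma triple_covered x : exists u v, F (tev q x - xi u v).
Proof.
have [n [y [ry hy]]] := reach_every_height (height x).
have := reach_tile ry tile0; rewrite mulr0 add0r => Fy.
case: x y hy {ry} Fy => -[a b] c [[a' b'] c'] hy Fy.
exists (Z.sub b b'), (Z.sub a a').
suff -> : tev q (a, b, c) - xi (Z.sub b b') (Z.sub a a') = tev q (a', b', c') by [].
rewrite -tev_opp -tev_add; congr (tev q _).
by move: hy; rewrite /tadd /topp /height0 /tri /height => hy; congr (_, _, _); lia.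
Qed.

(** [1] and [q] span a lattice of the plane; rounding [z / q^N] in it leaves an error of at most 2,
    which [q^N] contracts. *)
Lemma triples_dense z (e : R) : 0 < e -> exists x, normc (tev q x - z) <= e.
Proof.
move=> e0; have [N /(_ N (leqnn N)) Ne] := geometric_small 2 (ltW r0) r_lt1 e0.
pose w := z / q ^+ N.
pose b := Num.floor (complex.Im w / complex.Im q).
pose a := Num.floor (complex.Re w - b%:~R * complex.Re q).
exists (tscale N (Z_of_int a, Z_of_int b, Z0)).
rewrite tev_mulx_iter// (_ : z = q ^+ N * w); last by rewrite /w mulrC divfK// expf_neq0.
rewrite -mulrBr Normc.normcM normcX (le_trans _ Ne)// ler_wpM2l ?exprn_ge0 ?(ltW r0)//.
rewrite /tev /zr !Z_of_intK rmorph0 mul0r addr0.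
have := floor_le_tmp (complex.Im w / complex.Im q).
have := lt_succ_floor (complex.Im w / complex.Im q).
have := floor_le_tmp (complex.Re w - b%:~R * complex.Re q).
have := lt_succ_floor (complex.Re w - b%:~R * complex.Re q).
rewrite -/a -/b !intrD => a1 a2 b1 b2.
have iq1 := Im_le_normc q.
set d := _ - w.
have dRe : complex.Re d = a%:~R + b%:~R * complex.Re q - complex.Re w.
  rewrite /d; case: (q) (w) => x y [x' y'] /=.
  by rewrite -!(rmorph_int (real_complex R)) /= mul0r subr0.
have dIm : complex.Im d = - complex.Im q * (complex.Im w / complex.Im q - b%:~R).
  rewrite mulrBr mulNr (mulrC _ (_ / _)) divfK// /d; case: (q) (w) => x y [x' y'] /=.
  by rewrite -!(rmorph_int (real_complex R)) /= mul0r addr0; ring.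
have [h1 h2] : `|complex.Re d| <= 1 /\ `|complex.Im d| <= 1.
  split; first by rewrite dRe ler_norml; apply/andP; split; lra.
  rewrite dIm normrM normrN -[leRHS]mulr1 ler_pM//.
    by rewrite (le_trans iq1)// ltW.
  by rewrite ler_norml; apply/andP; split; lra.
by rewrite (le_trans (normc_le_ReIm _))//; lra.
Qed.

Lemma lattice_bounded (M : R) : exists L : seq (Z * Z),
  forall u v, normc (xi u v) <= M -> (u, v) \in L.
Proof.
have [l lM] := bounded_Z (2 * M).
exists [seq (u, v) | u <- l, v <- l] => u v uvM.
have M0 : 0 <= M := le_trans (normc_ge0 _) uvM.
have n2 : normc (xi u v) ^+ 2 <= M ^+ 2 by rewrite lerXn2r ?nnegrE ?normc_ge0.
have := lattice_normc_ge q3 qIm u v.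
have := sqr_ge0 (zr R u); have := sqr_ge0 (zr R v) => v0 u0 uv.
have small (x : R) : x ^+ 2 <= 2 * M ^+ 2 -> `|x| <= 2 * M.
  move=> x2; have M2 : 0 <= 2 * M by rewrite mulr_ge0.
  rewrite -(ler_pXn2r (n := 2)) ?nnegrE// real_normK ?num_real// exprMn (le_trans x2)//.
  by have := sqr_ge0 M; lra.
by apply: allpairs_f; apply: lM; apply: small; lra.
Qed.

(** Only finitely many translates come within distance 1 of [z], and each of them is closed. *)
Lemma lattice_avoid z (P : pred (Z * Z)) :
  (forall u v, P (u, v) -> ~ F (z - xi u v)) ->
  exists2 e : R, 0 < e & forall x u v, normc (x - z) < e -> P (u, v) -> ~ F (x - xi u v).
Proof.
move=> zP.
have [L Lz] := lattice_bounded (normc z + 1 + 191 / 100).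
suff [e e0 eL] : exists2 e : R, 0 < e & forall x u v, normc (x - z) < e ->
    (u, v) \in L -> P (u, v) -> ~ F (x - xi u v).
  exists (Num.min e 1); first by rewrite lt_min e0 ltr01.
  move=> x u v; rewrite lt_min => /andP[xe x1] Puv Fx.
  apply: (eL x u v xe) => //; apply: Lz.
  have -> : xi u v = z + (x - z) - (x - xi u v) by ring.
  rewrite (le_trans (normcD _ _))// normcN lerD//; last exact: tile_radius.
  by rewrite (le_trans (normcD _ _))// lerD// ltW.
elim: L {Lz} => [|[u v] L [e e0 eL]]; first by exists 1.
have [Puv|nPuv] := boolP (P (u, v)); last first.
  exists e => // x u' v' xe; rewrite inE => /orP[/eqP[-> ->]|]; last exact: eL.
  by rewrite (negPf nPuv).
have [d d0 dF] : exists2 d : R, 0 < d & forall x, normc (x - z) < d -> ~ F (x - xi u v).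
  apply: contrapT => nd; apply: (zP _ _ Puv); apply: Fclosed => d d0.
  apply: contrapT => nx; apply: nd; exists d => // x xd Fx; apply: nx.
  by exists (x - xi u v) => //; rewrite opprB addrA subrK.
exists (Num.min e d); first by rewrite lt_min e0.
move=> x u' v'; rewrite lt_min => /andP[xe xd].
rewrite inE => /orP[/eqP[-> ->] _|]; [exact: dF|exact: eL].
Qed.

(** A point off all tiles would have a neighbourhood off all tiles, but that contains an element of
    the dense ring Z[q]. *)
Lemma tile_covering z : exists u v, F (z - xi u v).
Proof.
apply: contrapT => nz.
have [|e e0 eF] := @lattice_avoid z xpredT.
  by move=> u v _ Fz; apply: nz; exists u, v.
have e2 : 0 < e / 2 by rewrite divr_gt0.
have [x xz] := triples_dense z e2; have [u [v]] := triple_covered x.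
apply: eF => //; apply: (le_lt_trans xz).
by rewrite ltr_pdivrMr// ltr_pMr// ltr1n.
Qed.

(** Were [z] off all other tiles, so would be a neighbourhood; by the covering this would lie in
    [F], making [z] interior. *)
Lemma boundary_neighbor z : boundary F z ->
  exists u v, ~~ ((u == 0) && (v == 0)) /\ piece (0%N, height0 u v) z.
Proof.
move=> [/closure_normcP/Fclosed Fz nint]; apply: contrapT => nz.
have [|e e0 eF] := @lattice_avoid z (fun p => ~~ ((p.1 == 0) && (p.2 == 0))).
  move=> u v uv Fzu; apply: nz; exists u, v; split => //; split => //=.
  by rewrite expr0 divr1.
apply: nint; apply/interior_normcP; exists e => // x xz.
have [u [v Fx]] := tile_covering x.
have [/andP[/eqP u0 /eqP v0]|uv] := boolP ((u == 0) && (v == 0)); last first.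
  by have := eF x u v xz uv.
move: Fx; rewrite u0 v0 /tev /=.
by rewrite !(mul0r, addr0, subr0).
Qed.

Lemma tile_zoom z n : F z -> exists e t, [/\ (n <= e)%N,
   (forall w, F w -> F (q ^+ e * w + t)) & exists2 w, F w & z = q ^+ e * w + t].
Proof.
move=> Fz; elim: n => [|n [e [t [ne Ft [w Fw zw]]]]].
  exists 0%N, 0; split => // [w Fw|]; first by rewrite expr0 mul1r addr0.
  by exists z => //; rewrite expr0 mul1r addr0.
move: Fw; rewrite Fsplit => -[Fw|Fw].
  exists (e + 2)%N, t; split=> [|w' Fw'|]; first lia.
    by rewrite exprD -mulrA; apply: Ft; exact: tile_branchL.
  exists (w / q ^+ 2) => //; rewrite exprD -mulrA (mulrC (q ^+ 2)) divfK ?expf_neq0//.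
exists (e + 3)%N, (t - q ^+ (e + 3)); split=> [|w' Fw'|]; first lia.
  rewrite (_ : _ + _ = q ^+ e * (q ^+ 3 * (w' - 1)) + t); last by rewrite exprD; ring.
  by apply: Ft; exact: tile_branchR.
exists (w / q ^+ 3 + 1) => //; rewrite zw mulrDr mulr1 exprD.
rewrite -mulrA (mulrCA (q ^+ 3)) mulfV ?expf_neq0// mulr1.
by ring.
Qed.

(** Countably many translates of [F] cover the plane, which is not negligible. *)
Lemma tile_not_null : ~ ball_null 2 F.
Proof.
move=> nF; apply: (@lebesgue2_setT R).
pose A n : set R[i] := if (@unpickle (Z * Z)%type) n is Some uv
  then [set z | F (z - xi uv.1 uv.2)] else set0.
have cover : [set: R * R] `<=` \bigcup_n [set p : R * R | A n (p.1 +i* p.2)].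
  move=> [x y] _; have [u [v Fz]] := tile_covering (x +i* y).
  suff [n An] : exists n, A n (x +i* y) by exists n.
  by exists (pickle (u, v)); rewrite /A pickleK.
suff [B [mB B0 AB]] : (@lebesgue_measure R \x @lebesgue_measure R)%E.-negligible
    (\bigcup_n [set p : R * R | A n (p.1 +i* p.2)]).
  by exists B; split => // p _; apply: AB; exact: cover.
apply: negligible_bigcup => n; apply: ball_null_negligible; rewrite /A.
case: unpickle => [[u v]|]; last exact: ball_null0.
apply: (@ball_null_affine _ _ _ F 1 (- xi u v)) => // z.
by rewrite mul1r.
Qed.

(** If [z] were interior to [F], a small copy of [F] around [z] inside the neighbouring tile would
    lie in [F] too. It would then be part of a null intersection, although [F] is not null. *)
Lemma neighbor_boundary u v z : ball_null 2 (piece stX) ->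
  ~~ ((u == 0) && (v == 0)) -> piece (0%N, height0 u v) z -> boundary F z.
Proof.
move=> nX uv [Fz]; rewrite expr0 divr1 => Fzu.
split; first exact: subset_closure.
move=> /interior_normcP[d d0 dF]; apply: tile_not_null.
(* 4 exceeds the diameter bound [2 * 1.91] of [F], so copies with exponent at least [N] fit into the
   ball of radius [d]. *)
have [N /(_ _) Nd] := geometric_small 4 (ltW r0) r_lt1 (divr_gt0 d0 (ltr0n R 2)).
have [e [t [Ne Ft [w0 Fw0 zw]]]] := tile_zoom N Fzu.
apply: (@ball_null_affine _ _ _ (piece (0%N, height0 u v)) (q ^+ e) (t + xi u v)).
- by rewrite expf_neq0.
- move=> w Fw; split; last by rewrite /= expr0 divr1 addrA addrK; exact: Ft.
  apply: dF; rewrite (_ : _ - z = q ^+ e * (w - w0)).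
    rewrite Normc.normcM normcX.
    have ww : normc (w - w0) <= 4.
      rewrite (le_trans (normcD _ _))// normcN.
      by have := tile_radius Fw; have := tile_radius Fw0; lra.
    apply: (le_lt_trans (ler_wpM2l (exprn_ge0 _ (ltW r0)) ww)).
    rewrite (le_lt_trans (Nd _ Ne))//.
    by rewrite ltr_pdivrMr// ltr_pMr// ltr1n.
  rewrite -[z](subrK (xi u v)) zw. ring.
- exact: neighbor_null.
Qed.

Lemma boundary_null s : ball_null s (piece stX) -> ball_null s (boundary F).
Proof.
move=> nX; have [L LM] := lattice_bounded (191 / 50).
apply: (@ball_null_sub _ _ _ (fun z => exists2 p : Z * Z, p \in L &
    ~~ ((p.1 == 0) && (p.2 == 0)) /\ piece (0%N, height0 p.1 p.2) z)).
  move=> z /boundary_neighbor[u [v [uv pz]]]; exists (u, v) => //; apply: LM.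
  case: pz => /tile_radius h1; rewrite expr0 divr1 => /tile_radius h2.
  rewrite -[xi u v](subKr z) (le_trans (normcD _ _))// normcN.
  by lra.
elim: L {LM} => [|p L IH].
  by apply: (@ball_null_sub _ _ _ set0) => [z []|]; last exact: ball_null0.
apply: (@ball_null_sub _ _ _ ((fun z => ~~ ((p.1 == 0) && (p.2 == 0)) /\
   piece (0%N, height0 p.1 p.2) z) `|` (fun z => exists2 p : Z * Z, p \in L &
    ~~ ((p.1 == 0) && (p.2 == 0)) /\ piece (0%N, height0 p.1 p.2) z))).
  move=> z [p']; rewrite inE => /orP[/eqP -> h|pL h]; first by left.
  by right; exists p'.
apply: ball_nullU IH.
have [p0|p0] := boolP ((p.1 == 0) && (p.2 == 0)).
  by apply: (@ball_null_sub _ _ _ set0) => [z []|]; last exact: ball_null0.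
apply: (@ball_null_sub _ _ _ (piece (0%N, height0 p.1 p.2))) => [z []//|].
exact: neighbor_null.
Qed.

End Covering.

(** * Cells of the boundary set and their masses *)

Section Words.
Variables (R : realType) (q : R[i]).
Hypotheses (q3 : q ^+ 3 = q - 1) (qIm : complex.Im q != 0).
Variable F : set R[i]^o.
Hypotheses (Fcompact : compact F) (Fne : F !=set0).
Hypothesis Fsplit : forall z, F z <-> F (z / q ^+ 2) \/ F (z / q ^+ 3 + 1).

Local Notation rho := (2 * complex.Re q).
Local Notation r := (normc q).
Local Notation X := (piece q F stX).
Let q0 : q != 0 := plastic_q0 q3.
Let r0 : 0 < r := plastic_normc_gt0 q3.
Let r_lt1 : r < 1. Proof. by have := plastic_normc_lt q3 qIm; lra. Qed.
Let tile_radius := tile_radius q3 qIm Fcompact Fsplit.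
Let Fclosed := compact_closed_normc Fcompact.

(** The witness is the fixed point of [w |-> q^4 w - q^2]. The square of this map is the branch word
    right-left-right, so the point is in [F]; and [(z + q) / q = q^3 (z - 1)] is in [F] as a right
    branch image. *)
Lemma pieceX_nonempty : exists z, X z.
Proof.
pose b := - q ^+ 2; pose z := b / (1 - q ^+ 4).
have q4 : 1 - q ^+ 4 != 0.
  apply/eqP => h; have : normc (q ^+ 4) = 1.
    by rewrite -Normc.normc1; congr normc; rewrite -[RHS](subrK (q ^+ 4)) h add0r.
  rewrite normcX => h'; have : r ^+ 4 < 1 by rewrite exprn_ilt1// ltW.
  by rewrite h' ltxx.
have zfix : z = q ^+ 4 * z + b by rewrite /z; field.
have tX : tev q (tri 0 (-1) 0) = - q.
  by rewrite /tev /= !zr0 !mul0r add0r addr0 (@zrN R[i] 1%coqZ) zr1 mulN1r.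
(* This identity matches the translation parts of the two expressions of the squared map. *)
have q8 : q ^+ 8 + q ^+ 3 = q ^+ 6 + q ^+ 2.
  apply/eqP; rewrite -subr_eq0; apply/eqP.
  transitivity ((q ^+ 3 - (q - 1)) * (q ^+ 5 - q ^+ 2)); first by ring.
  by rewrite q3 subrr mul0r.
have q4E : q ^+ 4 = q ^+ 2 - q by rewrite exprSr q3; ring.
have branchL := @tile_branchL _ _ q3 _ Fsplit.
have branchR := @tile_branchR _ _ q3 _ Fsplit.
have Fz : F z.
  apply: (@tile_fixpoint _ _ q3 qIm _ Fcompact Fne 8 _ (q ^+ 4 * b + b)) => // [w Fw|].
    rewrite (_ : _ + _ = q ^+ 3 * (q ^+ 2 * (q ^+ 3 * (w - 1)) - 1)); last first.
      transitivity (q ^+ 8 * w - (q ^+ 6 + q ^+ 2)); first by rewrite /b; ring.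
      by rewrite -q8; ring.
    by apply/branchR/branchL/branchR.
  by rewrite {1}zfix {1}zfix; ring.
exists z; split => //; change (F ((z - tev q (tri 0 (-1) 0)) / q ^+ 1)).
rewrite expr1 tX opprK.
have -> : (z + q) / q = q ^+ 3 * (z - 1).
  apply: (mulIf q0); rewrite divfK// [in LHS]zfix /b.
  transitivity (q ^+ 4 * z - (q ^+ 2 - q)); first by ring.
  by rewrite -q4E; ring.
exact: branchR.
Qed.

Lemma pieceX_compact : compact (X : set R[i]^o).
Proof.
apply: (@subclosed_compact _ _ F) => //; last by move=> z [].
apply/closed_normcP => z Xz; split; apply: Fclosed => e e0.
  by have [x [Fx _] xz] := Xz e e0; exists x.
have [|x [_ Fx] xz] := Xz (e * r); first by rewrite mulr_gt0.
exists ((x - tev q stX.2) / q ^+ stX.1) => //.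
rewrite -mulrBl opprB addrA subrK Normc.normcM Normc.normcV expr1.
by rewrite ltr_pdivrMr.
Qed.

Definition letter (b : bool) : similarity :=
  if b then (5, tri 1 (-2) 1)%N else (4, tri 0 0 (-1))%N.

(* The head of a word is the innermost similarity. *)
Fixpoint wsim (w : seq bool) : similarity :=
  if w is b :: w' then sim_comp (wsim w') (letter b) else (0%N, tri 0 0 0).

Local Notation wexp w := (wsim w).1.

Definition cell w z := X (pull q (wsim w) z).

Lemma cell_nil z : cell [::] z <-> X z.
Proof. by rewrite /cell pull_id. Qed.

Lemma cell_split w z : cell w z <-> cell (false :: w) z \/ cell (true :: w) z.
Proof.
rewrite /cell -[wsim (false :: w)]/(sim_comp (wsim w) (letter false)).
rewrite -[wsim (true :: w)]/(sim_comp (wsim w) (letter true)) !pull_comp//.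
exact (pieceX_selfsimilar q3 qIm Fcompact Fsplit _).
Qed.

Lemma cell_nonempty w : exists z, cell w z.
Proof.
have [z Xz] := pieceX_nonempty; exists (q ^+ (wexp w) * z + tev q (wsim w).2).
by rewrite /cell /pull addrK mulrC mulKf// expf_neq0.
Qed.

(** The real Galois conjugate of [q]. *)
Let eta := - rho.
Let eta3 : eta ^+ 3 = eta - 1.
Proof. by have := plastic_rho3 q3 qIm; rewrite /eta => h; lra. Qed.

(* Galois conjugation turns the letters into expanding maps of the line whose
   inverses send [0.8, 1.2] into its two halves, so the head letter of a word
   can be read off the image of 1. *)
Definition decode w : R := pull eta (wsim w) 1.

Lemma decode_letter b x : 8 / 10 <= x <= 12 / 10 ->
  8 / 10 <= pull eta (letter b) x <= 12 / 10 /\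
  (if b then 1 < pull eta (letter b) x else pull eta (letter b) x < 1).
Proof.
have r3 := plastic_rho3 q3 qIm.
have /andP[l u] := plastic_bounds r3.
have {l u} [l u] : 1324 / 1000 < rho /\ rho < 1325 / 1000 by split; lra.
move=> /andP[x8 x12].
have e4 : eta ^+ 4 = rho ^+ 2 + rho.
  by rewrite /eta; transitivity (rho * rho ^+ 3); [ring|rewrite r3; ring].
have e5 : eta ^+ 5 = - (rho ^+ 2 + rho + 1).
  transitivity (- (rho ^+ 2 * rho ^+ 3)); first by rewrite /eta; ring.
  by rewrite r3; transitivity (- (rho ^+ 3 + rho ^+ 2)); [ring|rewrite r3; ring].
have p4 : 0 < rho ^+ 2 + rho by nra.
have p5 : 0 < rho ^+ 2 + rho + 1 by lra.
case: b; rewrite /letter /pull /=.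
  rewrite e5 invrN mulrN -mulNr.
  rewrite (_ : zr R 1 = 1)// (_ : zr R (-2)%coqZ = -2)//.
  rewrite (ler_pdivlMr _ _ p5) (ler_pdivrMr _ _ p5) (ltr_pdivlMr _ _ p5) /eta.
  move: (rho) l u {e4 e5 p4 p5 r3} => p l u.
  by split; [apply/andP; split|]; nra.
rewrite e4 (_ : zr R (-1)%coqZ = -1)// !zr0 !mul0r !add0r.
rewrite (ler_pdivlMr _ _ p4) (ler_pdivrMr _ _ p4) (ltr_pdivrMr _ _ p4) /eta.
move: (rho) l u {e4 e5 p4 p5 r3} => p l u.
by split; [apply/andP; split|]; nra.
Qed.

Lemma decode_cons b w : decode (b :: w) = pull eta (letter b) (decode w).
Proof. by rewrite /decode /= pull_comp. Qed.

Lemma decode_range w : 8 / 10 <= decode w <= 12 / 10.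
Proof.
elim: w => [|b w IH]; last by rewrite decode_cons; have [] := decode_letter b IH.
by rewrite /decode pull_id; apply/andP; split; lra.
Qed.

(** The decoded value lies above or below 1 according to the head letter; once the letters agree,
    they cancel from the composition. *)
Lemma wsim_inj : injective wsim.
Proof.
have pos b w : wexp (b :: w) != 0%N by case: b => /=; lia.
elim=> [|b w IH] [|b' w'] // e.
- by have := pos b' w'; rewrite -e.
- by have := pos b w; rewrite e.
have bb : b = b'.
  have : decode (b :: w) = decode (b' :: w') by rewrite /decode e.
  rewrite !decode_cons.
  have [_] := decode_letter b (decode_range w).
  have [_] := decode_letter b' (decode_range w').
  by case: b b' {e} => -[] //= h1 h2 h; move: h1; rewrite -h ltNge ltW.
rewrite bb in e *; congr cons; apply: IH; move: e.
rewrite /= /sim_comp; case: (wsim w) (wsim w') => n t [n' t'] /= -[/addIn nn].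
rewrite -nn; case: t t' => -[a1 a2] a3 [[c1 c2] c3].
case: (tscale n _) => -[g1 g2] g3 /= [] h1 h2 h3.
by congr (_, (_, _, _)); lia.
Qed.

(** Solving the definition of [decode w] gives the conjugate offset [1 - decode w * eta^n], where
    [decode w] is at most 1.2. *)
Lemma wsim_conj w : `|tev eta (wsim w).2| <= 3 * rho ^+ (wexp w).
Proof.
have /andP[l u] := decode_range w.
have r3 := plastic_rho3 q3 qIm.
have rho1 : 1 < rho by have /andP[h _] := plastic_bounds r3; lra.
have re : 1 <= rho ^+ (wexp w) by rewrite exprn_ege1// ltW.
have e0 : eta ^+ (wexp w) != 0 by rewrite expf_neq0// (cubic_root_neq0 eta3).
have -> : tev eta (wsim w).2 = 1 - decode w * eta ^+ (wexp w).
  by rewrite /decode /pull divfK// subKr.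
rewrite (le_trans (ler_normB _ _))// normr1 normrM normrX normrN.
rewrite (gtr0_norm (_ : 0 < rho)); last by lra.
rewrite ger0_norm; last by lra.
nra.
Qed.

End Words.

(** Z[q] is discrete in the product of its complex and real embeddings: the coordinates are linear
    in the real part, the imaginary part and the real conjugate. *)
Lemma bounded_triples (R : realType) (q : R[i]) (q3 : q ^+ 3 = q - 1)
  (qIm : complex.Im q != 0) (M : R) :
  exists L : seq triple, forall t, normc (tev q t) <= M ->
    `|tev (- (2 * complex.Re q)) t| <= M -> t \in L.
Proof.
have r3 := plastic_rho3 q3 qIm; have rn := plastic_normc2 q3 qIm.
have /andP[l u] := plastic_bounds r3.
have {l u} [l u] : 13 / 10 < 2 * complex.Re q /\ 2 * complex.Re q < 14 / 10 by split; lra.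
pose N := `|M| + `|M / complex.Im q|.
have [lz lzP] := bounded_Z (20 * N).
exists [seq (x.1, x.2, c) | x <- [seq (a, b) | a <- lz, b <- lz], c <- lz].
move=> [[a b] c] tM sM.
suff [ha hb hc] : [/\ `|zr R a| <= 20 * N, `|zr R b| <= 20 * N & `|zr R c| <= 20 * N].
  by apply/allpairsP; exists ((a, b), c); rewrite /= !lzP//; split=> //; apply: allpairs_f; exact: lzP.
have := le_trans (Re_le_normc _) tM; have := le_trans (Im_le_normc _) tM.
move: sM; rewrite /tev.
have zC z : zr R[i] z = (zr R z)%:C by rewrite /zr rmorph_int.
rewrite !zC; move: rn; rewrite normc_sqr /N; move: qIm l u {r3 tM q3 lzP}.
case: (q) => x y /= y0 l u rn.
move: (zr R a) (zr R b) (zr R c) => A B C.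
rewrite !(mul0r, mulr0, subr0, addr0, add0r).
set p := 2 * x in l u rn *.
have px : p = 2 * x by [].
clearbody p.
have y2 : y * y = 3 * (x * x) - 1 by rewrite px in rn; lra.
have x2 : x * x - y * y = 1 - p ^+ 2 / 2 by rewrite y2 px; field.
have xp : x = p / 2 by rewrite px; field.
rewrite x2 (_ : B * y + C * (x * y + y * x) = y * (B + C * p)); last by rewrite xp; field.
rewrite {1}xp normrM => hS hQ hP.
have {hQ} hQ : `|B + C * p| <= `|M / y|.
  rewrite normrM normfV ler_pdivlMr ?normr_gt0// mulrC (le_trans hQ)//.
  exact: ler_norm.
have {}hP := le_trans hP (ler_norm M); have {}hS := le_trans hS (ler_norm M).
move: (`|M|) (`|M / y|) hQ hP hS => m n hQ hP hS.
(* A linear combination of the three bounded quantities eliminates [A] and [B]. *)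
have hC : `|C| * (3 * p ^+ 2 - 1) <= 2 * m + 3 * n.
  have p2 : 0 < 3 * p ^+ 2 - 1 by nra.
  rewrite -[X in _ * X](gtr0_norm p2) -normrM.
  rewrite (_ : C * _ = (A + B * - p + C * (- p) ^+ 2) - (A + B * (p / 2) + C * (1 - p ^+ 2 / 2))
    + (3 * p / 2) * (B + C * p)); last by field.
  rewrite (le_trans (ler_normD _ _))// lerD//.
    by rewrite (le_trans (ler_normB _ _))//; lra.
  rewrite normrM gtr0_norm; last by lra.
  by rewrite ler_pM//; lra.
have m0 := le_trans (normr_ge0 _) hS; have n0 := le_trans (normr_ge0 _) hQ.
have {}hC : `|C| <= m + n.
  have p4 : 4 <= 3 * p ^+ 2 - 1 by nra.
  by have := ler_wpM2l (normr_ge0 C) p4; lra.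
have Cp : `|C| * p <= `|C| * (14 / 10) by rewrite ler_wpM2l// ltW.
have hB : `|B| <= 2 * m + 3 * n.
  rewrite (_ : B = (B + C * p) - C * p); last by ring.
  rewrite (le_trans (ler_normB _ _))// normrM (gtr0_norm (_ : 0 < p)); last by lra.
  by lra.
have Bp : `|B| * p <= `|B| * (14 / 10) by rewrite ler_wpM2l// ltW.
have Cp2 : `|C| * p ^+ 2 <= `|C| * 2 by rewrite ler_wpM2l//; nra.
have hA : `|A| <= 8 * m + 8 * n.
  rewrite (_ : A = (A + B * - p + C * (- p) ^+ 2) + B * p - C * p ^+ 2); last by ring.
  have p0 : 0 < p by lra.
  rewrite (le_trans (ler_normB _ _))// [`|C * _|]normrM normrX.
  have := ler_normD (A + B * - p + C * (- p) ^+ 2) (B * p).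
  rewrite [`|B * p|]normrM (gtr0_norm p0).
  by lra.
by split; lra.
Qed.

(** The cut set of words whose exponent first reaches [k]. Letters add 4 or 5, so these exponents
    stay below [k + 5], and from the empty word fuel [k] suffices. *)
Fixpoint stop (k f : nat) (w : seq bool) : seq (seq bool) :=
  if f is f'.+1 then
    if (k <= (wsim w).1)%N then [:: w] else stop k f' (false :: w) ++ stop k f' (true :: w)
  else [:: w].

Lemma wexp_false w : (wsim (false :: w)).1 = ((wsim w).1 + 4)%N. Proof. by []. Qed.
Lemma wexp_true w : (wsim (true :: w)).1 = ((wsim w).1 + 5)%N. Proof. by []. Qed.

Lemma stop_wexp k f w v : ((wsim w).1 < k + 5)%N -> (k <= (wsim w).1 + f)%N ->
  v \in stop k f w -> (k <= (wsim v).1 < k + 5)%N.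
Proof.
elim: f w => [|f IH] w w5 kf.
  by rewrite inE => /eqP ->; rewrite w5 -{1}(addn0 ((wsim w).1)) kf.
rewrite [stop _ _ _]/=; case: (leqP k ((wsim w).1)) => kw; first by rewrite inE => /eqP ->; rewrite kw.
by rewrite mem_cat => /orP[]; apply: IH; rewrite ?wexp_false ?wexp_true; lia.
Qed.

Lemma stop_suffix k f w v : v \in stop k f w -> exists u, v = u ++ w.
Proof.
elim: f w => [|f IH] w; first by rewrite inE => /eqP ->; exists [::].
rewrite [stop _ _ _]/=; case: (leqP k ((wsim w).1)) => kw; first by rewrite inE => /eqP ->; exists [::].
rewrite mem_cat => /orP[] /IH[u ->]; [exists (rcons u false)|exists (rcons u true)];
  by rewrite cat_rcons.
Qed.

Lemma stop_uniq k f w : uniq (stop k f w).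
Proof.
elim: f w => [//|f IH] w; rewrite [stop _ _ _]/=; case: (leqP k ((wsim w).1)) => // kw.
(* Words of the two halves extend [false :: w] and [true :: w]; read backwards, they differ right
   after [w]. *)
rewrite cat_uniq !IH andbT /=; apply/hasPn => v /stop_suffix[u vu].
apply/negP => /stop_suffix[u' vu']; move: vu'; rewrite vu => /(congr1 rev).
rewrite !rev_cat !rev_cons => /eqP; rewrite -!cats1 -!catA eqseq_cat//.
by move=> /andP[_].
Qed.

Lemma stop_root_wexp k v : v \in stop k k [::] -> (k <= (wsim v).1 < k + 5)%N.
Proof. by apply: stop_wexp; rewrite //= addnS. Qed.

Lemma tadd_inj t : injective (tadd^~ t).
Proof.
move=> [[a b] c] [[a' b'] c']; case: t => -[x y] z /= [] h1 h2 h3.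
by congr (_, _, _); lia.
Qed.

(** * Mass distribution on the words *)

Section Mass.
Variables (R : realType) (q : R[i]).
Hypotheses (q3 : q ^+ 3 = q - 1) (qIm : complex.Im q != 0).
Variable F : set R[i]^o.
Hypotheses (Fcompact : compact F) (Fne : F !=set0).
Hypothesis Fsplit : forall z, F z <-> F (z / q ^+ 2) \/ F (z / q ^+ 3 + 1).
Variable d : R.
Local Notation r := (normc q).
Hypotheses (d0 : 0 < d) (dE : r `^ (4 * d) + r `^ (5 * d) = 1).

Local Notation X := (piece q F stX).
Local Notation wexp w := (wsim w).1.
Local Notation cell := (cell q F).
Let q0 : q != 0 := plastic_q0 q3.
Let r0 : 0 < r := plastic_normc_gt0 q3.
Let r_lt1 : r < 1. Proof. by have := plastic_normc_lt q3 qIm; lra. Qed.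
Let tile_radius := tile_radius q3 qIm Fcompact Fsplit.

(** The natural weight of a word is [tau] to its exponent, the [d]-th power of its contraction
    ratio; the Moran equation says that the letter weights sum to 1. *)
Let tau := r `^ d.
Let tau0 : 0 < tau. Proof. exact: powR_gt0. Qed.
Let tauE : tau ^+ 4 + tau ^+ 5 = 1.
Proof.
rewrite -!powR_mulrn ?(ltW tau0)// -!powRrM (mulrC d) (mulrC d).
exact: dE.
Qed.
Let tau_lt1 : tau < 1.
Proof.
rewrite ltNge; apply/negP => h; have := exprn_ege1 4 h; have := exprn_ege1 5 h.
by have := tauE; lra.
Qed.

Definition meets (U : set R[i]) w := exists2 z, cell w z & U z.

Definition weight (U : set R[i]) w : R :=
  if `[< meets U w >] then tau ^+ (wexp w) else 0.

(** A finite-depth substitute for the natural measure of [U], not increasing in [j], which avoids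
    constructing a measure. *)
Fixpoint mass (U : set R[i]) (j : nat) (w : seq bool) : R :=
  if j is j'.+1 then mass U j' (false :: w) + mass U j' (true :: w) else weight U w.

Lemma weight_ge0 U w : 0 <= weight U w.
Proof. by rewrite /weight; case: ifP => // _; rewrite exprn_ge0// ltW. Qed.

Lemma meets_cons U b w : meets U (b :: w) -> meets U w.
Proof.
move=> [z cz Uz]; exists z => //; apply/(cell_split q3 qIm Fcompact Fsplit).
by case: b cz; [right|left].
Qed.

Lemma weight_split w :
  tau ^+ (wexp (false :: w)) + tau ^+ (wexp (true :: w)) = tau ^+ (wexp w).
Proof. by rewrite /= !exprD -mulrDr tauE mulr1. Qed.

Lemma weight_cons_le U w : weight U (false :: w) + weight U (true :: w) <= weight U w.
Proof.
rewrite /weight; case: (asboolP (meets U w)) => [_|nU].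
  by rewrite -[leRHS]weight_split lerD//; case: ifP => // _; rewrite exprn_ge0// ltW.
rewrite !asboolF ?addr0// => /meets_cons//.
Qed.

Lemma mass_le U j w : mass U j w <= weight U w.
Proof.
elim: j w => [|j IH] w //=.
by rewrite (le_trans _ (weight_cons_le U w))// lerD.
Qed.

(** Every cell of depth [j] is non-empty and so meets some [U i]: its weight is counted at least
    once. *)
Lemma mass_cover (m : nat) (U : nat -> set R[i]) j w :
  (forall z, cell w z -> exists2 i, (i < m)%N & U i z) ->
  tau ^+ (wexp w) <= \sum_(i < m) mass (U i) j w.
Proof.
elim: j w => [|j IH] w Uw /=.
  have [z cz] := cell_nonempty q3 qIm Fcompact Fne Fsplit w.
  have [i im Uz] := Uw z cz.
  rewrite (bigD1 (Ordinal im))//= {1}/weight asboolT; last by exists z.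
  by rewrite lerDl sumr_ge0// => k _; exact: weight_ge0.
rewrite big_split/= -weight_split lerD// IH// => z cz; apply: Uw;
  apply/(cell_split q3 qIm Fcompact Fsplit); [left|right]; exact: cz.
Qed.

Lemma mass_stop U k f j w : (f <= j)%N ->
  mass U j w <= \sum_(v <- stop k f w) weight U v.
Proof.
elim: f j w => [|f IH] j w fj; first by rewrite big_seq1 mass_le.
rewrite [stop _ _ _]/=; case: ifP => kw; first by rewrite big_seq1 mass_le.
case: j fj => // j; rewrite ltnS => fj; by rewrite big_cat/= lerD ?IH.
Qed.

(** Relative to one word [v0] meeting the ball, a word is determined by its excess exponent, below
    5, and by the difference of offsets divided by [q^k]. Both conjugates of this element of Z[q]
    are bounded independently of [k] and [c]. *)
Lemma stop_count : exists M : nat, forall k (c : R[i]),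
  (count (fun v => `[< meets [set z | (normc (z - c) < r ^+ k)%R] v >])
     (stop k k [::]) <= M)%N.
Proof.
(* The complex values are at most [3 + 3]. The real ones are at most [12 + 12], each 12 being
   [3 rho^4] with [rho^4 <= 4]. *)
have [L LP] := bounded_triples q3 qIm 24.
have r3 := plastic_rho3 q3 qIm.
have eta3 : (- (2 * complex.Re q)) ^+ 3 = - (2 * complex.Re q) - 1 by lra.
have /andP[l u] := plastic_bounds r3.
have {l u} [l u] : 13 / 10 < 2 * complex.Re q /\ 2 * complex.Re q < 14 / 10 by split; lra.
set rho := 2 * complex.Re q in r3 eta3 l u LP.
have rho0 : 0 < rho by lra.
exists (size [seq (i, t) | i <- iota 0 5, t <- L]) => k c; rewrite -size_filter.
set S := [seq v <- _ | _].
have [->//|[v0 v0S]] : S = [::] \/ exists v, v \in S.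
  by case: (S) => [|v s]; [left|right; exists v; exact: mem_head].
have SP v : v \in S -> [/\ (k <= wexp v)%N, (wexp v < k + 5)%N &
    normc (tev q (wsim v).2 - c) <= 3 * r ^+ k].
  rewrite mem_filter => /andP[/asboolP[z [Xz _] /= zc] vs].
  have /andP[kv vk] := stop_root_wexp vs.
  split => //; have nz := tile_radius Xz.
  rewrite (_ : _ - c = (z - c) - pull q (wsim v) z * q ^+ wexp v); last first.
    by rewrite /pull divfK ?expf_neq0//; ring.
  rewrite (le_trans (normcD _ _))// normcN Normc.normcM normcX.
  have rk : r ^+ wexp v <= r ^+ k by rewrite ler_wiXn2l// ltW.
  have := ler_pM (normc_ge0 _) (exprn_ge0 _ (ltW r0)) nz rk.
  by have := ltW zc; have := exprn_ge0 k (ltW r0); lra.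
pose diff v := tunscale k (tadd (wsim v).2 (topp (wsim v0).2)).
pose code v := ((wexp v - k)%N, diff v).
have tev_diff (K : fieldType) (x : K) (x3 : x ^+ 3 = x - 1) v :
    tev x (diff v) = (tev x (wsim v).2 - tev x (wsim v0).2) / x ^+ k.
  by rewrite /diff tev_divx_iter// tev_add tev_opp.
have code_inj : {in S &, injective code}.
  move=> v v' /SP[kv vk _] /SP[kv' vk' _] [e1 e2]; apply: wsim_inj.
    exact: q3. exact: qIm.
  have ee : wexp v = wexp v' by rewrite -(subnKC kv) e1 subnKC.
  have e3 : tadd (wsim v).2 (topp (wsim v0).2) = tadd (wsim v').2 (topp (wsim v0).2).
    have iterK : cancel (tunscale k) (tscale k).
      by rewrite /tunscale /tscale; elim: (k) => [//|n IH] t; rewrite iterSr [iter n.+1 tdivx t]iterS tdivxK IH.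
    by rewrite -[LHS]iterK -[RHS]iterK -/(diff v) -/(diff v') e2.
  by rewrite [wsim v]surjective_pairing [wsim v']surjective_pairing ee (tadd_inj e3).
rewrite -(size_map code); apply: uniq_leq_size.
  by rewrite (map_inj_in_uniq code_inj) filter_uniq// stop_uniq.
move=> _ /mapP[v vS ->]; apply/allpairsP; exists (code v); split => //=.
  have [kv vk _] := SP v vS; rewrite /code; move: (wexp v) kv vk => n kv vk.
  by have : (n - k)%N \in iota 0 5 by rewrite mem_iota add0n ltn_subLR.
have [kv vk vc] := SP v vS; have [kv0 vk0 vc0] := SP v0 v0S.
have rk0 : 0 < r ^+ k by rewrite exprn_gt0.
apply: LP.
  rewrite tev_diff// Normc.normcM Normc.normcV normcX ler_pdivrMr//.
  rewrite (_ : _ - _ = (tev q (wsim v).2 - c) - (tev q (wsim v0).2 - c)); last by ring.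
  by rewrite (le_trans (normcD _ _))// normcN; lra.
rewrite tev_diff// normrM normfV normrX normrN (gtr0_norm rho0) ler_pdivrMr ?exprn_gt0//.
have bnd w : (k <= wexp w)%N -> (wexp w < k + 5)%N ->
    `|tev (- rho) (wsim w).2| <= 12 * rho ^+ k.
  move=> kw wk; have := wsim_conj q3 qIm w; rewrite -/rho => h.
  apply: (le_trans h).
  have rho4 : rho ^+ 4 <= 4.
    by rewrite exprS r3; nra.
  have : rho ^+ wexp w <= rho ^+ (k + 4).
    by rewrite ler_weXn2l; [|lra|rewrite -ltnS -addnS].
  by rewrite exprD; have := exprn_ge0 k (ltW rho0); nra.
rewrite (le_trans (ler_normB _ _))//.
by have := bnd v kv vk; have := bnd v0 kv0 vk0; lra.
Qed.

Lemma mass_ball : exists2 M : R, 0 < M & forall c (delta : R), 0 < delta ->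
  exists K, forall j, (K <= j)%N ->
    mass [set z | normc (z - c) < delta] j [::] <= M * delta `^ d.
Proof.
have [M MP] := stop_count.
(* The added 1 makes [M'] at least 1, as needed for [delta > 1]; the division by [tau] pays for the
   ratio between [r^k] and [r^k.+1]. *)
pose M' := (M%:R + 1) / tau.
have M1 : 1 <= M'.
  rewrite /M' ler_pdivlMr// mul1r (le_trans (ltW tau_lt1))// lerDr//.
exists M' => [|c delta de0]; first by rewrite (lt_le_trans _ M1).
have [de1|de1] := leP 1 delta.
  exists 0%N => j _; apply: (le_trans (mass_le _ _ _)).
  apply: (@le_trans _ _ 1).
    by rewrite /weight; case: ifP.
  rewrite -[leLHS]mulr1 ler_pM//.
  by rewrite -[leLHS](powRr0 delta) ler_powR// ltW.
have ex : exists k, r ^+ k <= delta.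
  have [N /(_ N (leqnn N))] := geometric_small 1 (ltW r0) r_lt1 de0.
  by rewrite mulr1; exists N.
(* Minimality places [delta] in the interval [[r^k.+1, r^k[]. *)
case: (ex_minnP ex) => -[|k]; first by rewrite expr0 leNgt de1.
move=> rk kmin; have rk' : delta < r ^+ k.
  by rewrite ltNge; apply/negP => /kmin; rewrite ltnn.
exists k => j kj; apply: (le_trans (@mass_stop _ k k _ _ kj)).
have -> : \sum_(v <- stop k k [::]) weight [set z | normc (z - c) < delta] v =
    \sum_(v <- stop k k [::] | `[< meets [set z | normc (z - c) < delta] v >]) tau ^+ wexp v.
  by rewrite [RHS]big_mkcond.
apply: (@le_trans _ _ (\sum_(v <- stop k k [::] |
    `[< meets [set z | normc (z - c) < r ^+ k] v >]) tau ^+ k)).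
  rewrite big_seq_cond [leRHS]big_seq_cond.
  rewrite [leLHS]big_mkcond [leRHS]big_mkcond; apply: ler_sum => v _.
  case: ifPn => [/andP[vs /asboolP[z cz /= zd]]|_].
    rewrite vs asboolT/=; last by exists z => //=; exact: lt_trans zd rk'.
    rewrite ler_wiXn2l ?(ltW tau0) ?(ltW tau_lt1)//.
    by have /andP[] := stop_root_wexp vs.
  by case: ifP => // _; rewrite exprn_ge0// ltW.
rewrite big_const_seq iter_addr_0 -[_ *+ _]mulr_natl.
have tk : tau ^+ k <= delta `^ d / tau.
  rewrite ler_pdivlMr// -exprSr /tau -powR_mulrn ?powR_ge0// -powRrM mulrC powRrM.
  by rewrite powR_mulrn ?(ltW r0)// ge0_ler_powR// ?nnegrE ?exprn_ge0 ?ltW// .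
rewrite /M' mulrAC -mulrA ler_pM// ?exprn_ge0 ?(ltW tau0)//.
by rewrite (le_trans (_ : _ <= M%:R)) ?ler_nat ?MP// lerDl.
Qed.

(** The mass distribution principle: the total mass 1 is at most the sum of the masses of the balls.
    Compactness leaves finitely many balls, so one depth [J] serves them all. *)
Lemma pieceX_ball_cover : exists2 C : R, 0 < C &
  forall (c : nat -> R[i]) (delta : nat -> R), (forall n, 0 < delta n) ->
  (forall z, X z -> exists n, normc (z - c n) < delta n) ->
  exists m, C <= \sum_(n < m) delta n `^ d.
Proof.
have [M M0 MP] := mass_ball.
exists M^-1 => [|c delta de0 cov]; first by rewrite invr_gt0.
have [m mP] := compact_ball_cover (pieceX_compact q3 Fcompact) cov.
exists m.
have [J JP] : exists J, forall i, (i < m)%N ->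
    mass [set z | normc (z - c i) < delta i] J [::] <= M * delta i `^ d.
  have /choice[K KP] := fun i => MP (c i) (delta i) (de0 i).
  exists (\max_(i < m) K i) => i im; apply: KP.
  exact: (leq_bigmax (Ordinal im)).
rewrite -(ler_pM2l M0) mulfV ?gt_eqF// mulr_sumr.
apply: (@le_trans _ _ (\sum_(i < m) mass [set z | normc (z - c i) < delta i] J [::])).
  rewrite -[leLHS](expr0 tau); apply: (@mass_cover m (fun i => [set z | normc (z - c i) < delta i]) J [::]) => z.
  by rewrite cell_nil => /mP.
by apply: ler_sum => i _; exact: JP.
Qed.

End Mass.

(** * Hausdorff dimension of the boundary *)

Section HausdorffLower.
Variable R : realType.
Implicit Types (A : set R[i]) (s d C : R).

Lemma powR_le_base1 (x s d : R) : 0 <= x <= 1 -> 0 < d -> s <= d -> x `^ d <= x `^ s.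
Proof.
move=> /andP[x0 x1] d0 sd; have [->|xn] := eqVneq x 0.
  by rewrite powR0 ?gt_eqF// powR_ge0.
have xp : 0 < x by rewrite lt_def xn.
by rewrite /powR gt_eqF// ler_expR ler_wnM2r// ln_le0.
Qed.

Lemma powR_lt_base1 (x s d : R) : 0 < x < 1 -> d < s -> x `^ s < x `^ d.
Proof.
move=> /andP[x0 x1] ds; rewrite /powR gt_eqF// ltr_expR ltr_nM2r// ln_lt0//.
by rewrite x0.
Qed.

(** Sets of diameter at most 1 are replaced by balls centred at one of their points; for such sets,
    lowering the exponent from [d] to [s] only increases the gauge. *)
Lemma ball_cover_hausdorff_gt0 A C d s : 0 < C -> 0 < d -> s <= d ->
  (forall (c : nat -> R[i]) (delta : nat -> R), (forall n, 0 < delta n) ->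
    (forall z, A z -> exists n, normc (z - c n) < delta n) ->
    exists m, C <= \sum_(n < m) delta n `^ d) ->
  hausdorff_measure s A != 0%E.
Proof.
move=> C0 d0 sd Acov; pose C' := C / 2 / 2 `^ d.
have p2 : 0 < 2 `^ d :> R by rewrite powR_gt0.
have C'0 : 0 < C' by rewrite !divr_gt0.
suff h : (C'%:E <= hausdorff_premeasure s 1 A)%E.
  have : (C'%:E <= hausdorff_measure s A)%E.
    by apply: (le_trans h); apply: ereal_sup_ubound; exists 1 => //=; exact: ltr01.
  by move=> h'; apply/eqP => h0; move: h'; rewrite h0 lee_fin leNgt C'0.
apply: le_ereal_inf_tmp => _ [U [Ud AU] <-].
pose D n : R := if `[< U n !=set0 >] then fine (diameter (U n)) else 0.
have DP n : U n !=set0 -> diameter (U n) = (D n)%:E /\ 0 <= D n <= 1.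
  move=> Un; rewrite /D asboolT//; have := Ud n; have := diameter_ge0 Un.
  by case: (diameter _) => [x| |] //=; rewrite !lee_fin => -> ->.
have D01 n : 0 <= D n <= 1.
  have [/DP[]//|nU] := pselect (U n !=set0).
  by rewrite /D asboolF// lexx ler01.
have gaugeD n : ((D n `^ d)%:E <= gauge s (U n))%E.
  rewrite /gauge; case: ifPn => [/eqP U0|/set0P/DP[-> Dn]].
    by rewrite /D asboolF ?powR0 ?gt_eqF// U0 => -[].
  by rewrite /= lee_fin powR_le_base1.
(* The [d]-th powers of the [e n] sum to at most [C / 2], which leaves [C / 2] for the diameters. *)
pose e n := (C / 2 ^+ n.+2) `^ d^-1.
have e0 n : 0 < e n by rewrite powR_gt0// divr_gt0// exprn_gt0.
have /choice[c cP] : forall n, exists c, U n !=set0 -> U n c.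
  by move=> n; have [[x Ux]|nU] := pselect (U n !=set0); [exists x|exists 0].
(* Doubling makes the inclusion in an open ball strict; [e n] takes care of sets of diameter 0. *)
pose delta n := Num.max (2 * D n) (e n).
have [n||m Cm] := Acov c delta.
- by rewrite lt_max e0 orbT.
- move=> z /AU[n _ Uz]; have Un : U n !=set0 by exists z.
  exists n; have [dn /andP[Dn _]] := DP n Un.
  have zD : normc (z - c n) <= D n.
    rewrite -lee_fin -dn; apply: ereal_sup_ubound; exists z => //; exists (c n) => //.
    exact: cP.
  apply: (le_lt_trans zD); rewrite lt_max.
  have [->|nz] := eqVneq (D n) 0; first by rewrite e0 orbT.
  by rewrite ltr_pMl ?ltr1n// lt_def nz.
rewrite (nneseries_split 0 m); last by move=> k _; exact: gauge_ge0.
rewrite add0n big_mkord; apply: (@le_trans _ _ (\sum_(n < m) gauge s (U n))%E); last first.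
  by rewrite leeDl// nneseries_ge0// => n _ _; exact: gauge_ge0.
apply: (@le_trans _ _ (\sum_(n < m) (D n `^ d)%:E)%E); last by apply: lee_sum => n _.
rewrite sumEFin lee_fin.
have deltaD n : delta n `^ d <= 2 `^ d * D n `^ d + C / 2 ^+ n.+2.
  have /andP[Dn _] := D01 n.
  have eE : e n `^ d = C / 2 ^+ n.+2.
    by rewrite /e -powRrM mulVf ?gt_eqF// powRr1// divr_ge0 ?(ltW C0)// exprn_ge0.
  rewrite -powRM// -eE /delta /Num.max; case: ifP => _.
    by rewrite lerDr powR_ge0.
  by rewrite lerDl powR_ge0.
have tail k : \sum_(n < k) (C / 2 ^+ n.+2) = C / 2 - C / 2 ^+ k.+1.
  elim: k => [|k IH]; first by rewrite big_ord0 expr1 subrr.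
  rewrite big_ord_recr/= IH !exprS; field.
  by rewrite expf_neq0.
have tail_le : \sum_(n < m) (C / 2 ^+ n.+2) <= C / 2.
  by rewrite tail gerBl divr_ge0 ?(ltW C0)// exprn_ge0.
have : C <= 2 `^ d * (\sum_(n < m) D n `^ d) + C / 2.
  apply: (le_trans Cm); rewrite mulr_sumr.
  apply: (@le_trans _ _ (\sum_(n < m) (2 `^ d * D n `^ d + C / 2 ^+ n.+2))).
    by apply: ler_sum => n _.
  by rewrite big_split/= lerD2l.
rewrite mulrC; set t := _ * _ => Ct.
by rewrite /C' ler_pdivrMr// -/t; lra.
Qed.

End HausdorffLower.

Section Dimension.
Variables (R : realType) (q : R[i]).
Hypotheses (q3 : q ^+ 3 = q - 1) (qIm : complex.Im q != 0).
Variable F : set R[i]^o.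
Hypotheses (Fcompact : compact F) (Fne : F !=set0).
Hypothesis Fsplit : forall z, F z <-> F (z / q ^+ 2) \/ F (z / q ^+ 3 + 1).
Local Notation r := (normc q).
Local Notation X := (piece q F stX).
Let q0 : q != 0 := plastic_q0 q3.
Let r0 : 0 < r := plastic_normc_gt0 q3.
Let r_lt1 : r < 1. Proof. by have := plastic_normc_lt q3 qIm; lra. Qed.

Lemma pieceX_null_gt s d : 0 < d -> d < s -> r `^ (4 * d) + r `^ (5 * d) = 1 ->
  ball_null s X.
Proof.
move=> d0 ds dE; apply: (pieceX_null q3 qIm Fcompact Fsplit); first exact: lt_trans d0 ds.
rewrite -[ltRHS]dE; apply: ltrD; (apply: powR_lt_base1; first by rewrite r0 r_lt1).
  by rewrite ltr_pM2l.
by rewrite ltr_pM2l.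
Qed.

(** Above [d], the boundary is covered by finitely many null intersections. Below, it contains a
    copy of [X] scaled by [|q|^3], so its ball covers pull back to covers of [X]. The bound [d < 2]
    makes [X] null in dimension 2, as [neighbor_boundary] requires. *)
Lemma boundary_dim d : 0 < d -> d < 2 -> r `^ (4 * d) + r `^ (5 * d) = 1 ->
  hausdorff_dim (boundary F) = d%:E.
Proof.
move=> d0 d2 dE; have nX2 := pieceX_null_gt d0 d2 dE.
apply/eqP; rewrite eq_le; apply/andP; split.
  apply/lee_addgt0Pr => e e0; apply: ereal_inf_lbound.
  exists (d + e) => //; have de : d < d + e by rewrite ltrDl.
  split; first by rewrite addr_ge0 ?ltW.
  apply: ball_null_hausdorff; first by rewrite addr_gt0.
  apply: (boundary_null q3 qIm Fcompact Fne Fsplit).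
  exact: pieceX_null_gt de dE.
apply: le_ereal_inf_tmp => _ [s [/= s0 Hs] <-]; rewrite lee_fin leNgt; apply/negP => sd.
have [C C0 CP] := pieceX_ball_cover q3 qIm Fcompact Fne Fsplit d0 dE.
pose f : similarity := (3, tri 1 (-1) 0)%N.
have r3d : 0 < (r ^+ 3) `^ d by rewrite powR_gt0// exprn_gt0.
move: Hs; apply/eqP; apply: (@ball_cover_hausdorff_gt0 _ _ (C * (r ^+ 3) `^ d) d) => //.
- by rewrite mulr_gt0.
- exact: ltW.
move=> c delta de0 cov.
have [n|z Xz|m Cm] := CP (fun n => pull q f (c n)) (fun n => delta n / r ^+ 3).
- by rewrite divr_gt0// exprn_gt0.
- pose z' := q ^+ 3 * z + tev q f.2.
  have z'z : pull q f z' = z by rewrite /pull /z' addrK mulrC mulKf// expf_neq0.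
  have Bz : boundary F z'.
    (* The coordinates 0 and 1 stand for the neighbour at [1 - q^2]. *)
    apply: (@neighbor_boundary _ _ q3 qIm _ Fcompact Fne Fsplit 0%coqZ 1%coqZ) => //.
    apply: (pieceX_neighbor q3 qIm Fcompact Fsplit).
    by rewrite -/f z'z.
  have [n zn] := cov _ Bz; exists n.
  rewrite -[z in z - _]z'z /pull -mulrBl opprB addrA subrK Normc.normcM.
  by rewrite Normc.normcV normcX ltr_pM2r// invr_gt0 exprn_gt0.
exists m; rewrite -ler_pdivlMr// mulr_suml (le_trans Cm)//.
apply: ler_sum => n _; rewrite powRM ?(ltW (de0 n))//; last first.
  by rewrite invr_ge0 exprn_ge0// ltW.
have -> : (r ^+ 3)^-1 `^ d = ((r ^+ 3) `^ d)^-1.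
  by rewrite -(powR_inv1 (exprn_ge0 3 (ltW r0))) -powRrM mulN1r powRN.
by [].
Qed.

End Dimension.

(** * Numerical estimates *)

Lemma zr_nat (K : pzRingType) (z : Z) (n : nat) : int_of_Z z = Posz n -> zr K z = n%:R.
Proof. by rewrite /zr => ->. Qed.

(* Otherwise conversion computes numerals of [Z] in unary. *)
Local Opaque zr.

(* Powers of a rational with denominator 10^9 in fixed-point arithmetic with
   12 decimals, rounded up and down. *)
Fixpoint pow_up (M : Z) (n : nat) : Z :=
  if n is n'.+1 then (pow_up M n' * M / 1000000000 + 1)%coqZ else 1000000000000%coqZ.

Fixpoint pow_down (M : Z) (n : nat) : Z :=
  if n is n'.+1 then (pow_down M n' * M / 1000000000)%coqZ else 1000000000000%coqZ.

Local Notation nano := 1000000000%coqZ.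

Section FixedPoint.
Variable R : realFieldType.

Lemma nano_gt0 : 0 < zr R nano. Proof. exact: (@zr_lt R 0%coqZ nano erefl). Qed.

Lemma pow_up_ge (x : R) M n : 0 <= x -> x <= zr R M / zr R nano ->
  x ^+ n * zr R (pow_up M 0) <= zr R (pow_up M n).
Proof.
move=> x0; rewrite (ler_pdivlMr _ _ nano_gt0) => xM.
elim: n => [|n IH]; first by rewrite expr0 mul1r.
rewrite -(ler_pM2r nano_gt0) exprSr.
rewrite -[_ * _ * zr R nano]mulrA mulrACA.
have S0 : 0 <= zr R (pow_up M 0) by apply: (@zr_le R 0%coqZ); apply/Z.leb_le.
apply: (@le_trans _ _ (zr R (pow_up M n) * zr R M)).
  apply: ler_pM; [| |exact: IH|exact: xM].
    by apply: mulr_ge0; [exact: exprn_ge0|exact: S0].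
  by apply: mulr_ge0; [exact: x0|exact: ltW nano_gt0].
rewrite -!zrM; apply: zr_le; rewrite -[pow_up M n.+1]/(pow_up M n * M / nano + 1)%coqZ.
move: (Z.mul (pow_up M n) M) => a.
by have := Z.mul_succ_div_gt a nano erefl; move: (Z.div a nano) => b; lia.
Qed.

Lemma pow_down_le (x : R) M n : Z.le 0 M -> zr R M / zr R nano <= x ->
  zr R (pow_down M n) <= x ^+ n * zr R (pow_down M 0) /\ Z.le 0 (pow_down M n).
Proof.
move=> M0; rewrite (ler_pdivrMr _ _ nano_gt0) => xM.
elim: n => [|n [IH I0]].
  by split; [rewrite expr0 mul1r lexx|apply/Z.leb_le].
have d0 : Z.le 0 (pow_down M n * M / nano) by apply: Z.div_pos; [exact: Z.mul_nonneg_nonneg|exact: erefl].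
split; last exact: d0.
rewrite -(ler_pM2r nano_gt0) exprSr.
rewrite -[_ * _ * zr R nano]mulrA mulrACA.
apply: (@le_trans _ _ (zr R (pow_down M n) * zr R M)); last first.
  apply: ler_pM; [| |exact: IH|exact: xM].
    exact: (@zr_le R 0%coqZ _ I0).
  exact: (@zr_le R 0%coqZ _ M0).
rewrite -!zrM; apply: zr_le; rewrite -[pow_down M n.+1]/(pow_down M n * M / nano)%coqZ.
move: (Z.mul (pow_down M n) M) => a.
by have := Z.mul_div_le a nano erefl; move: (Z.div a nano) => b; lia.
Qed.

Lemma expr_lt_of_bounds (x y : R) (M A : Z) (m n : nat) :
  0 <= x -> Z.leb 0 A -> x <= zr R M / zr R nano -> zr R A / zr R nano <= y ->
  Z.ltb (pow_up M m) (pow_down A n) -> x ^+ m < y ^+ n.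
Proof.
move=> x0 /Z.leb_le A0 xM yA /Z.ltb_lt/(@zr_lt R) h.
have S0 : 0 < zr R (pow_up M 0) by apply: (@zr_lt R 0%coqZ); exact: erefl.
rewrite -(ltr_pM2r S0); apply: le_lt_trans (pow_up_ge m x0 xM) (lt_le_trans h _).
by have [] := pow_down_le n A0 yA.
Qed.

(** Blocks of three digits keep the unary naturals small. *)
Lemma zr_digits z (b c e : nat) :
  z = (((1000 + Z.of_nat b) * 1000 + Z.of_nat c) * 1000 + Z.of_nat e)%coqZ ->
  zr R z / zr R nano = 1 + b%:R / 10 ^+ 3 + c%:R / 10 ^+ 6 + e%:R / 10 ^+ 9.
Proof.
move=> ->; rewrite -[nano]/(1000 * 1000 * 1000)%coqZ !(zrD, zrM).
have nat n : zr R (Z.of_nat n) = n%:R by apply: zr_nat; lia.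
rewrite !nat (_ : zr R 1000%coqZ = 1000); last exact: zr_nat.
by move: (b%:R) (c%:R) (e%:R) => {}b {}c {}e; lra.
Qed.

End FixedPoint.

Lemma cubic_root_gt1 (R : realFieldType) (x : R) : x * (x - 1) ^+ 2 = 1 -> 1 < x.
Proof.
move=> e; rewrite ltNge; apply/negP => x1.
have x0 : 0 < x.
  rewrite ltNge; apply/negP => x0; have : x * (x - 1) ^+ 2 <= 0.
    by rewrite mulr_le0_ge0 ?sqr_ge0.
  by rewrite e ler10.
have h : 0 <= x * (1 - x) by apply: mulr_ge0; lra.
have : 0 <= x * (1 - x) * x by apply: mulr_ge0; lra.
by nra.
Qed.

(** Squaring [rho (rho^2 - 1) = 1] shows that [rho^2] solves the same cubic, which has only one root
    above 1. *)
Lemma plastic_sqr (R : realType) (rho alpha : R) : rho ^+ 3 = rho + 1 ->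
  alpha * (alpha - 1) ^+ 2 = 1 -> alpha = rho ^+ 2.
Proof.
move=> r3 ae; have be : rho ^+ 2 * (rho ^+ 2 - 1) ^+ 2 = 1.
  transitivity ((rho ^+ 3 - rho) ^+ 2); first by ring.
  by rewrite r3; ring.
have a1 := cubic_root_gt1 ae; have b1 := cubic_root_gt1 be.
move: (rho ^+ 2) be b1 => B be b1.
have h : (alpha - B) * ((alpha - 1) ^+ 2 + (alpha - 1) * (B - 1) + (B - 1) ^+ 2
    + (alpha - 1) + (B - 1)) = 0.
  transitivity (alpha * (alpha - 1) ^+ 2 - B * (B - 1) ^+ 2); first by ring.
  by rewrite ae be subrr.
move/eqP: h; rewrite mulf_eq0 => /orP[|/eqP h]; first by rewrite subr_eq0 => /eqP.
have := sqr_ge0 (alpha - 1); have := sqr_ge0 (B - 1).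
have : 0 < (alpha - 1) * (B - 1) by rewrite mulr_gt0// subr_gt0.
by move: h; lra.
Qed.

(** * The dominant root of the quintic *)

Local Notation quintic R := ('X^5 - 2 *: 'X^3 + 'X - 1 : {poly R}).

Lemma horner_quintic (K : comNzRingType) (x : K) :
  (quintic K).[x] = x * (x ^+ 2 - 1) ^+ 2 - 1.
Proof. by rewrite !hornerE/=; ring. Qed.

Lemma quintic_root (R : realType) : exists mu : R,
  [/\ mu * (mu ^+ 2 - 1) ^+ 2 = 1,
      1 + 362 / 10 ^+ 3 + 598 / 10 ^+ 6 + 577 / 10 ^+ 9 <= mu
    & mu <= 1 + 362 / 10 ^+ 3 + 598 / 10 ^+ 6 + 578 / 10 ^+ 9].
Proof.
set a := _ + 577 / _; set b := _ + 578 / _.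
have [||mu /andP[am mb] /eqP] := @poly_ivt R (quintic R) a b.
- by rewrite /a /b; lra.
- rewrite !horner_quintic /a /b; apply/andP; split; lra.
rewrite horner_quintic => /eqP.
by rewrite subr_eq0 => /eqP e; exists mu; split.
Qed.

(** If [n = |w| >= mu], then [n (n^2 - 1)^2 <= n |w^2 - 1|^2 = 1] forces [n = mu] and equality in
    the triangle inequality. Hence [w^2 = mu^2], and the equation, linear in [w] once [w^2] is
    known, gives [w = mu]. *)
Lemma quintic_dominant (R : realType) (mu : R) : 1 < mu ->
  mu * (mu ^+ 2 - 1) ^+ 2 = 1 -> dominant_root (quintic R[i]) mu%:C.
Proof.
move=> mu1 e; split.
  have := congr1 (real_complex R) e.
  rewrite rmorphM rmorphXn rmorphB rmorphXn rmorph1 => e'.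
  by rewrite rootE horner_quintic e' subrr.
move=> w; rewrite rootE horner_quintic subr_eq0 => /eqP we wmu.
rewrite !normcE ltcR normc_real gtr0_norm; last by lra.
set n := normc w.
have ne : n * normc (w ^+ 2 - 1) ^+ 2 = 1.
  by rewrite -normcX -Normc.normcM we Normc.normc1.
have n0 : 0 <= n := normc_ge0 _.
rewrite ltNge; apply/negP => mun.
have n1 : 1 < n := lt_le_trans mu1 mun.
have tri1 : n ^+ 2 - 1 <= normc (w ^+ 2 - 1).
  have := normcD (w ^+ 2 - 1) 1; rewrite subrK normcX Normc.normc1 -/n; lra.
have n2 : 0 < n ^+ 2 - 1 by nra.
have le1 : n * (n ^+ 2 - 1) ^+ 2 <= 1.
  rewrite -[leRHS]ne ler_pM2l; last by lra.
  by rewrite lerXn2r ?nnegrE ?normc_ge0 ?(ltW n2).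
have nmu : n = mu.
  apply/eqP; rewrite eq_le mun andbT leNgt; apply/negP => lt.
  move: le1; apply/negP; rewrite -ltNge -[ltLHS]e.
  apply: ltr_pM; rewrite ?sqr_ge0//; first by lra.
  have m2 : 1 < mu ^+ 2 by rewrite exprn_egt1.
  have h : mu ^+ 2 < n ^+ 2 by rewrite ltr_pXn2r ?nnegrE//; lra.
  by rewrite ltr_pXn2r ?nnegrE//; lra.
have eq2 : normc (w ^+ 2 - 1) = n ^+ 2 - 1.
  apply/eqP; rewrite eq_le tri1 andbT leNgt; apply/negP => lt.
  have : n * (n ^+ 2 - 1) ^+ 2 < n * normc (w ^+ 2 - 1) ^+ 2.
    by rewrite ltr_pM2l ?(lt_trans ltr01)// ltr_pXn2r ?nnegrE ?normc_ge0 ?(ltW n2).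
  by rewrite ne nmu e ltxx.
have w2 : w ^+ 2 = (n ^+ 2)%:C.
  have : normc (w ^+ 2) = n ^+ 2 by rewrite normcX.
  have n20 : 0 <= n ^+ 2 by rewrite sqr_ge0.
  move: eq2 n20; case: (w ^+ 2) => x y; move: (n ^+ 2) => N h1 N0 h2.
  have := congr1 (fun t => t ^+ 2) h1; have := congr1 (fun t => t ^+ 2) h2.
  rewrite !normc_sqr /= oppr0 addr0 => h3 h4.
  have xN : x = N by lra.
  have : y ^+ 2 = 0 by rewrite xN in h3; lra.
  by move=> /eqP; rewrite expf_eq0 /= => /eqP ->; rewrite xN.
move/eqP: wmu; apply.
have c0 : ((mu ^+ 2 - 1) ^+ 2)%:C != 0 :> R[i].
  by rewrite fmorph_eq0 expf_neq0// -nmu gt_eqF.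
apply: (mulIf c0); rewrite -rmorphM e rmorph1 -[RHS]we w2 nmu.
by congr (_ * _); rewrite rmorphXn rmorphB rmorph1.
Qed.

Lemma mu_pow_lt_rho_pow :
  (pow_up 1362598578 379 <? pow_down 1324717950 417)%coqZ.
Proof. by vm_compute. Qed.

Lemma rho_pow_lt_mu_pow :
  (pow_up 1324717960 428 <? pow_down 1362598577 389)%coqZ.
Proof. by vm_compute. Qed.

(** The fractions are about 1.100257 and 1.100264. Comparing the quotient of logarithms with each is
    an inequality between integer powers of [mu] and [rho]. *)
Lemma dimension_bounds (R : realType) (rho mu : R) : rho ^+ 3 = rho + 1 ->
  1 + 362 / 10 ^+ 3 + 598 / 10 ^+ 6 + 577 / 10 ^+ 9 <= mu ->
  mu <= 1 + 362 / 10 ^+ 3 + 598 / 10 ^+ 6 + 578 / 10 ^+ 9 ->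
  428 / 389 < ln mu / ln rho < 417 / 379.
Proof.
move=> /plastic_bounds/andP[l u] lm um.
have rl : 1 + 324 / 10 ^+ 3 + 717 / 10 ^+ 6 + 950 / 10 ^+ 9 <= rho by lra.
have ru : rho <= 1 + 324 / 10 ^+ 3 + 717 / 10 ^+ 6 + 960 / 10 ^+ 9 by lra.
have {l u} rho1 : 1 < rho by clear -rl; lra.
have mu1 : 1 < mu by clear -lm; lra.
have rho0 : 0 < rho := lt_trans ltr01 rho1.
have mu0 : 0 < mu := lt_trans ltr01 mu1.
have up : 379%:R * ln mu < 417%:R * ln rho.
  rewrite !mulr_natl -!lnXn// ltr_ln ?posrE ?exprn_gt0//.
  apply: (expr_lt_of_bounds (ltW mu0) _ _ _ mu_pow_lt_rho_pow); first by [].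
    by rewrite (@zr_digits R _ 362 598 578 (erefl : 1362598578%coqZ = _)); exact: um.
  by rewrite (@zr_digits R _ 324 717 950 (erefl : 1324717950%coqZ = _)); exact: rl.
have lo : 428%:R * ln rho < 389%:R * ln mu.
  rewrite !mulr_natl -!lnXn// ltr_ln ?posrE ?exprn_gt0//.
  apply: (expr_lt_of_bounds (ltW rho0) _ _ _ rho_pow_lt_mu_pow); first by [].
    by rewrite (@zr_digits R _ 324 717 960 (erefl : 1324717960%coqZ = _)); exact: ru.
  by rewrite (@zr_digits R _ 362 598 577 (erefl : 1362598577%coqZ = _)); exact: lm.
have lr : 0 < ln rho by rewrite ln_gt0.
rewrite (ltr_pdivlMr _ _ lr) (ltr_pdivrMr _ _ lr).
by move: up lo; clear; move: (ln mu) (ln rho) => x y up lo; apply/andP; split; lra.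
Qed.

(** * The tent tile *)

(** With [s = mu^(-1/2)] one has [r^(n d) = s^n], and the quintic equation becomes
    [(1 - s^4)^2 = s^10]; [s < 1] selects the root [1 - s^4 = s^5]. *)
Lemma plastic_moran (R : realType) (rho r mu : R) : 0 < r -> 1 < rho ->
  r ^+ 2 * rho = 1 -> 1 < mu -> mu * (mu ^+ 2 - 1) ^+ 2 = 1 ->
  let d := ln mu / ln rho in r `^ (4 * d) + r `^ (5 * d) = 1.
Proof.
move=> r0 rho1 rrho mu1 mue d.
have rho0 : 0 < rho := lt_trans ltr01 rho1.
have mu0 : 0 < mu := lt_trans ltr01 mu1.
have lrho : 0 < ln rho by rewrite ln_gt0.
have lr : ln r = - ln rho / 2.
  have := congr1 (@ln R) rrho; rewrite lnM ?posrE ?exprn_gt0// lnXn// ln1 mulr2n => h.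
  by lra.
pose s := expR (- ln mu / 2).
have s0 : 0 < s := expR_gt0 _.
have powE (n : nat) : r `^ (n%:R * d) = s ^+ n.
  rewrite /powR gt_eqF// -expRM_natl lr /d; congr expR.
  by field; rewrite gt_eqF.
have smu : s ^+ 2 * mu = 1.
  rewrite -expRM_natl -[mu]lnK ?posrE// -expRD -expR0; congr expR.
  by rewrite lnK ?posrE//; field.
have muE : mu = s ^- 2.
  by apply: (mulfI (_ : s ^+ 2 != 0)); rewrite ?smu ?mulfV// expf_neq0// gt_eqF.
have s1 : s < 1.
  rewrite ltNge; apply/negP => s1; have : 1 < s ^+ 2 * mu.
    by rewrite (lt_le_trans mu1)// ler_peMl ?exprn_ege1// ltW.
  by rewrite smu ltxx.
rewrite (powE 4%N) (powE 5%N).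
have sq : (1 - s ^+ 4) ^+ 2 = (s ^+ 5) ^+ 2.
  have -> : (s ^+ 5) ^+ 2 = s ^+ 10 * (mu * (mu ^+ 2 - 1) ^+ 2) by rewrite mue mulr1 -exprM.
  by rewrite muE; field; rewrite gt_eqF.
have s4 : s ^+ 4 < 1 by rewrite exprn_ilt1// ltW.
move/eqP: sq; rewrite eqf_sqr => /orP[] /eqP h; first by lra.
by have := exprn_gt0 5 s0; lra.
Qed.

Lemma proper_tiling_lattice (R : realType) (q : R[i]) (q3 : q ^+ 3 = q - 1)
    (qIm : complex.Im q != 0) (F : set R[i]^o) (Fcompact : compact F) (Fne : F !=set0)
    (Fsplit : forall z, F z <-> F (z / q ^+ 2) \/ F (z / q ^+ 3 + 1))
    (Xi : set R[i]) :
  (forall z, Xi z <-> exists u v, z = tev q (height0 u v)) ->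
  ball_null 2 (piece q F stX) ->
  proper_tiling Xi (fun x => [set x + y | y in F]).
Proof.
move=> XiP nX; have memP (x z : R[i]) : [set x + y | y in F] z <-> F (z - x).
  split=> [[y Fy <-]|Fz]; first by rewrite addrC addKr.
  by exists (z - x) => //; rewrite addrC subrK.
split.
- move=> x _; rewrite (_ : [set _ | _ in _] = [set 1 * y + x | y in F]).
    exact: compact_affine.
  by apply: eq_imagel => y _; rewrite mul1r addrC.
- apply/seteqP; split=> // z _.
  have [u [v Fz]] := tile_covering q3 qIm Fcompact Fne Fsplit z.
  exists (tev q (height0 u v)); first by apply/XiP; exists u, v.
  exact/memP.
- move=> K /compact_normc_bounded[M M0 KM].
  have [L LM] := lattice_bounded q3 qIm (M + 191 / 100).
  apply: (@sub_finite_set _ _ [set tev q (height0 p.1 p.2) | p in [set` L]]).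
    move=> x [/XiP[u [v ->]] [z [Kz /memP Fz]]]; exists (u, v) => //=; apply: LM.
    rewrite -[tev _ _](subKr z) (le_trans (normcD _ _))// normcN lerD ?KM//.
    exact: (tile_radius q3 qIm Fcompact Fsplit).
  by apply: finite_image; exact: finite_seq.
(* The pairs of distinct tiles are enumerated, so the multiply covered points form a countable union
   of translated neighbour intersections. *)
pose A n : set R[i] := if (@unpickle ((Z * Z) * (Z * Z))%type) n is Some p
  then [set z | p.1 != p.2 /\ F (z - tev q (height0 p.1.1 p.1.2)) /\
                F (z - tev q (height0 p.2.1 p.2.2))] else set0.
suff [B [mB B0 AB]] : (@lebesgue_measure R \x @lebesgue_measure R)%E.-negligible
    (\bigcup_n [set p : R * R | A n (p.1 +i* p.2)]).
  exists B; split => // p np; apply: AB; apply: contrapT => nA; apply: np.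
  pose z : R[i] := p.1 +i* p.2; have [u [v Fz]] := tile_covering q3 qIm Fcompact Fne Fsplit z.
  exists (tev q (height0 u v)); split.
    by split; [apply/XiP; exists u, v|apply/memP].
  move=> x [/XiP[u' [v' ->]] /memP Fz']; apply: contrapT => ne; apply: nA.
  suff [n An] : exists n, A n z by exists n; [exact: I|exact: An].
  exists (pickle ((u, v), (u', v'))); rewrite /A pickleK; split; last by split.
  by apply/eqP => -[uu vv]; apply: ne; rewrite uu vv.
apply: negligible_bigcup => n; apply: ball_null_negligible; rewrite /A.
case: unpickle => [[[u v] [u' v']]|]; last exact: ball_null0.
have [e|ne] := eqVneq (u, v) (u', v').
  by apply: (@ball_null_sub _ _ _ set0) => [z [/eqP]|]; last exact: ball_null0.
apply: (@ball_null_affine _ _ _ (piece q F (0%N, height0 (Z.sub u' u) (Z.sub v' v))) 1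
   (- tev q (height0 u v))); first exact: oner_neq0; last first.
  apply: (neighbor_null q3 qIm Fcompact Fsplit nX).
  apply: contra ne => /andP[/eqP h1 /eqP h2]; apply/eqP; congr (_, _).
    by move: h1 {nX Fsplit Fcompact}; clear; move: u u' => a b; lia.
  by move: h2 {nX Fsplit Fcompact}; clear; move: v v' => a b; lia.
move=> z [_ [Fz Fz']]; rewrite mul1r; split; first exact: Fz.
rewrite expr0 divr1 (_ : _ - _ = z - tev q (height0 u' v'))//.
rewrite -addrA -opprD -tev_add; congr (_ - tev q _).
by rewrite /height0 /tri /tadd; congr (_, _, _); clear; lia.
Qed.

Theorem theorem5p2 (R : realType) (alpha : R)
    (alpha_root : root ('X^3 - 2 *: 'X^2 + 'X - 1) alpha)
    (alpha' : R[i])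
    (alpha'_conj : galois_conjugate alpha%:C alpha')
    (alpha'_nonreal : complex.Im alpha' != 0)
    (psi : {rmorphism Qadj alpha -> R[i]})
    (psi_alpha : psi (Qgen alpha) = alpha')
    (F : set R[i]^o) :
  let a : Qadj alpha := Qgen alpha in
  let beta : Qadj alpha := a / (a - 1) in
  let Xi : set R[i] :=
    [set u1%:~R * psi (beta - a) + u2%:~R * psi (beta - a ^+ 2)
       | u1 in [set: int] & u2 in [set: int]] in
  ifs_attractor (fun x => psi a * x) (fun x => psi beta * (psi 1 - x)) F ->
  [/\ `|alpha - (1 + 754 / 10 ^+ 3 + 88 / 10 ^+ 5)| <= 5 / 10 ^+ 6,
      exists mu : R,
        [/\ dominant_root ('X^5 - 2 *: 'X^3 + 'X - 1) mu%:C,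
            `|mu - (1 + 362 / 10 ^+ 3 + 6 / 10 ^+ 4)| <= 5 / 10 ^+ 5,
            hausdorff_dim (boundary F) = (2 * ln mu / ln alpha)%:E
          & `|2 * ln mu / ln alpha - (1 + 100 / 10 ^+ 3 + 26 / 10 ^+ 5)| <= 5 / 10 ^+ 6]
    & proper_tiling Xi (fun x => [set x + y | y in F])].
Proof.
move=> a beta Xi [Fcompact Fne Feq].
have aE : alpha * (alpha - 1) ^+ 2 = 1.
  by move: alpha_root; rewrite rootE !hornerE/= => /eqP h; lra.
have pE : alpha' * (alpha' - 1) ^+ 2 = 1.
  have aE' : a * (a - 1) ^+ 2 = 1 by exact: val_inj.
  have := congr1 psi aE'.
  by rewrite rmorphM rmorphXn rmorphB rmorph1 psi_alpha.
(* By [pE], this is a square root of [alpha'] lying in Z[alpha']. *)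
pose q := alpha' - alpha' ^+ 2.
have q2 : q ^+ 2 = alpha'.
  by rewrite -[RHS]mulr1 -pE /q; ring.
have q3 : q ^+ 3 = q - 1.
  by rewrite exprSr q2 -[X in _ = _ - X]pE /q; ring.
have qIm : complex.Im q != 0.
  apply: contra alpha'_nonreal; rewrite -q2; case: (q) => x y /= /eqP ->.
  by rewrite mul0r mulr0 addr0.
have p10 : alpha' - 1 != 0.
  apply/eqP => h; have := pE; rewrite h expr0n mulr0 => /eqP.
  by rewrite eq_sym oner_eq0.
have psibeta : psi beta = - q ^+ 3.
  rewrite /beta fmorph_div rmorphB rmorph1 psi_alpha.
  apply: (mulIf p10); rewrite divfK// exprSr q2 -[LHS]mulr1 -[X in _ * X = _]pE /q; ring.
have psia : psi a = q ^+ 2 by rewrite psi_alpha.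
have q0 := plastic_q0 q3.
have Fsplit z : F z <-> F (z / q ^+ 2) \/ F (z / q ^+ 3 + 1).
  rewrite [in X in X <-> _]Feq psia psibeta rmorph1; split=> [[[x Fx <-]|[x Fx <-]]|[Fz|Fz]].
  - by left; rewrite mulrC mulKf// expf_neq0.
  - right; rewrite (_ : _ / _ + 1 = x)//; field.
    exact: q0.
  - by left; exists (z / q ^+ 2) => //; rewrite mulrC divfK// expf_neq0.
  - right; exists (z / q ^+ 3 + 1) => //; field.
    exact: q0.
have r3 := plastic_rho3 q3 qIm; set rho := 2 * complex.Re q in r3.
have alphaE : alpha = rho ^+ 2 := plastic_sqr r3 aE.
have /andP[rl ru] := plastic_bounds r3.
have rho1 : 1 < rho by clear -rl; lra.
have [mu [mue ml mu_u]] := quintic_root R.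
have mu1 : 1 < mu by clear -ml; lra.
have dE : 2 * ln mu / ln alpha = ln mu / ln rho.
  have lr : 0 < ln rho by rewrite ln_gt0.
  rewrite alphaE lnXn; last exact: lt_trans ltr01 rho1.
  by rewrite -mulr_natl; field; rewrite gt_eqF.
have /andP[dl du] := dimension_bounds r3 ml mu_u.
have d0 : 0 < ln mu / ln rho by clear -dl; lra.
have d2 : ln mu / ln rho < 2 by clear -du; lra.
have moran := plastic_moran (plastic_normc_gt0 q3) rho1 (plastic_normc2_rho q3 qIm) mu1 mue.
split.
- rewrite alphaE ler_norml; clear -rl ru rho1.
  by apply/andP; split; nra.
- exists mu; split.
  + exact: quintic_dominant.
  + by rewrite ler_norml; clear -ml mu_u; apply/andP; split; lra.
  + rewrite dE; exact: (boundary_dim q3 qIm Fcompact Fne Fsplit).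
  + by rewrite dE ler_norml; clear -dl du; apply/andP; split; lra.
- apply: (proper_tiling_lattice q3 qIm Fcompact Fne Fsplit); last first.
    exact: (pieceX_null_gt q3 qIm Fcompact Fsplit d0 d2 moran).
  (* The generators of [Xi] are [1 - q - q^2] and [1 - q^2], so [u = - u1] and [v = u1 + u2] is a
     unimodular change of coordinates. *)
  have gen u1 u2 : u1%:~R * psi (beta - a) + u2%:~R * psi (beta - a ^+ 2) =
      (u1 + u2)%:~R - u1%:~R * q - (u1 + u2)%:~R * q ^+ 2 :> R[i].
    rewrite !rmorphB rmorphXn psibeta psia q3 -exprM intrD.
    rewrite (_ : q ^+ (2 * 2) = q ^+ 2 - q); last by rewrite -[(2 * 2)%N]/3.+1 exprSr q3; ring.
    by ring.
  move=> z; split=> [[u1 _ [u2 _ <-]]|[u [v ->]]].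
    exists (Z_of_int (- u1)), (Z_of_int (u1 + u2)).
    by rewrite gen /tev /height0 /tri zrN !zrE !Z_of_intK rmorphN; ring.
  exists (- int_of_Z u) => //; exists (int_of_Z v + int_of_Z u) => //.
  by rewrite gen /tev /height0 /tri zrN !zrE !(intrD, rmorphN); ring.
Qed.
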